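(* There exist universal constants $C,D_1,D_2,\gamma>0$ such that the following holds. Let $0<q<1$, let $\Theta$ be a positive integer, let $I=[a,b]$, and let $\nu$ be a probability measure on $I$ with density $\nu(x)$. Let $N,m,s$ be positive integers and $K\ge 1$ with $$m\ge C K^2 s\log^3(s)\log(N+1).$$ Let $\{\psi_0,\psi_1,\dots,\psi_N\}$ be polynomials on $I$ that are orthonormal with respect to $\nu$, whose degrees are strictly increasing and do not exceed $N$, and that are uniformly bounded: $\|\psi_k\|_\infty\le K$ for $k=0,\dots,N$. Let $x_1,\dots,x_m$ be drawn independently from $I$, each with probability density $\nu(x)$, and let $A\in\mathbb{R}^{m\times(N+1)}$ have entries $A_{j,k}=\psi_k(x_j)$, $j=1,\dots,m$, $k=0,\dots,N$. Let $f\in C[a,b]$ be arbitrary, and put $\mathbf{y}=(f(x_1),\dots,f(x_m))^T$. Then, with probability at least $1-(N+1)^{-\gamma\log^3(s)}$, the following holds: if $\mathbf{c}^\#=(c_0^\#,\dots,c_N^\#)^T$ is a solution of $$\min_{\mathbf{z}\in\mathbb{R}^{N+1}}\|\mathbf{z}\|_1\quad\text{subject to}\quad \|A\mathbf{z}-\mathbf{y}\|_2\le\Theta\sqrt{m}\,E_N,$$ and $p^\#(x)=\sum_{k=0}^N c_k^\#\psi_k(x)$, then $$\|f-p^\#\|_\infty\le K D_1\,\sigma_s(\mathbf{c_{opt}})_1+\left(K D_2\Theta\sqrt{s}+1\right)E_N$$ and $$\|f-p^\#\|_\infty\le K D_1\,\|p_{opt}\|_{A_q}\,s^{1-\frac1q}+\left(K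 D_2\Theta\sqrt{s}+1\right)E_N.$$ Here $p_{opt}$ is the best uniform approximation polynomial of $f$ in $\Pi_N(I)=\mathrm{span}\{\psi_0,\dots,\psi_N\}$, $\mathbf{c_{opt}}$ is its coefficient vector in the basis $\{\psi_k\}_{k=0}^N$, and $E_N$ is the best uniform approximation error of $f$ in $\Pi_N(I)$.
   Context: $\|g\|_\infty=\max_{x\in[a,b]}|g(x)|$ for continuous $g$ on $[a,b]$. $\Pi_N(I)$ is the space of polynomials on $I$ of degree at most $N$. $E_N=E_N(f)=\inf_{p\in\Pi_N(I)}\|f-p\|_\infty$, and $p_{opt}\in\Pi_N(I)$ satisfies $\|f-p_{opt}\|_\infty=E_N$. Orthonormal with respect to $\nu$ means $\int_I\psi_j(x)\psi_k(x)\nu(x)\,dx=\delta_{jk}$. For a vector $\mathbf{z}$: $\|\mathbf{z}\|_p=(\sum_j|z_j|^p)^{1/p}$ for $0<p<\infty$ (a quasi-norm for $p<1$), $\|\mathbf{z}\|_0$ is the number of nonzero entries, and the best $s$-term approximation error is $\sigma_s(\mathbf{z})_p=\inf\{\|\mathbf{z}-\mathbf{x}\|_p:\|\mathbf{x}\|_0\le s\}$. For $g=\sum_{k=0}^N c_k\psi_k$, $\|g\|_{A_q}:=\|\mathbf{c}\|_q$, $q>0$. ''Universal constants'' means independent of all the other data. *)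

(* Defs.v *)
From mathcomp Require Import all_boot all_order all_algebra.
From mathcomp Require Import all_classical all_reals all_analysis.

Set Implicit Arguments.
Unset Strict Implicit.
Unset Printing Implicit Defensive.

Import Order.TTheory GRing.Theory Num.Theory.
Import numFieldNormedType.Exports.

Local Open Scope classical_set_scope.
Local Open Scope ring_scope.

(* [sup] is the junk value 0 on unbounded sets; for g continuous on [a, b]
   with a <= b the set below is compact and nonempty and [sup] is a maximum. *)
Definition supnorm (R : realType) (a b : R) (g : R -> R) : R :=
  sup [set `|g x| | x in `[a, b]].

(* [size p] is the degree plus one, and [size 0 = 0]. *)
Definition polys_upto (R : realType) (N : nat) : set {poly R} :=
  [set p | (size p <= N.+1)%N].

Definition best_approx_error (R : realType) (a b : R) (N : nat) (f : R -> R)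
    : R :=
  inf [set supnorm a b (fun x => f x - p.[x]) | p in @polys_upto R N].

Definition is_best_approx (R : realType) (a b : R) (N : nat) (f : R -> R)
    (p : {poly R}) : Prop :=
  @polys_upto R N p /\
  supnorm a b (fun x => f x - p.[x]) = best_approx_error a b N f.

(* Intended for p > 0; there 0 `^ p = 0. *)
Definition lpnorm (R : realType) (n : nat) (p : R) (z : 'cV[R]_n) : R :=
  (\sum_(j < n) `|z j 0| `^ p) `^ p^-1.

Definition l0norm (R : realType) (n : nat) (z : 'cV[R]_n) : nat :=
  #|[set j : 'I_n | z j 0 != 0]%SET|.

Definition best_term_error (R : realType) (n : nat) (s : nat) (p : R)
    (z : 'cV[R]_n) : R :=
  inf [set lpnorm p (z - x) | x in [set x : 'cV[R]_n | (l0norm x <= s)%N]].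

Definition expansion (R : realType) (N : nat) (psi : 'I_N.+1 -> {poly R})
    (c : 'cV[R]_N.+1) : {poly R} :=
  \sum_(k < N.+1) c k 0 *: psi k.

(* When the psi_k have strictly increasing degrees at most N, they form a basis
   of the polynomials of degree at most N, so for such g the vector exists and
   is unique; the default value 0 is only reached for g outside the span. *)
Definition coef_vector (R : realType) (N : nat) (psi : 'I_N.+1 -> {poly R})
    (g : {poly R}) : 'cV[R]_N.+1 :=
  xget 0 [set c | expansion psi c = g].

Definition Anorm (R : realType) (N : nat) (psi : 'I_N.+1 -> {poly R}) (q : R)
    (g : {poly R}) : R :=
  lpnorm q (coef_vector psi g).

Definition is_prob_density (R : realType) (a b : R) (nu : R -> R) : Prop :=
  [/\ measurable_fun `[a, b] nu,
      forall x, x \in `[a, b] -> 0 <= nu x &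
      (\int[lebesgue_measure]_(x in `[a, b]) (nu x)%:E = 1)%E].

Definition orthonormal_wrt (R : realType) (a b : R) (nu : R -> R) (N : nat)
    (psi : 'I_N.+1 -> {poly R}) : Prop :=
  forall j k : 'I_N.+1,
    (\int[lebesgue_measure]_(x in `[a, b])
       ((psi j).[x] * (psi k).[x] * nu x)%:E = ((j == k)%:R : R)%:E)%E.

Definition strictly_increasing_degrees (R : realType) (N : nat)
    (psi : 'I_N.+1 -> {poly R}) : Prop :=
  forall j k : 'I_N.+1, (j < k)%N -> (size (psi j) < size (psi k))%N.

Definition mutually_independent (d : measure_display) (T : measurableType d)
    (R : realType) (P : probability T R) (m : nat)
    (X : 'I_m -> {RV P >-> R}) : Prop :=
  forall (J : {set 'I_m}) (B : 'I_m -> set R),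
    (forall j, measurable (B j)) ->
    (P (\bigcap_(j in [set` J]) (X j @^-1` B j)) =
     \prod_(j in J) P (X j @^-1` B j))%E.

(* X is drawn from [a, b] with density nu; in particular X lies in [a, b]
   almost surely. *)
Definition has_density (d : measure_display) (T : measurableType d)
    (R : realType) (P : probability T R) (a b : R) (nu : R -> R)
    (X : {RV P >-> R}) : Prop :=
  forall B : set R, measurable B ->
    (distribution P X B =
     \int[lebesgue_measure]_(x in B `&` `[a, b]) (nu x)%:E)%E.

Definition sampling_matrix (R : realType) (N m : nat)
    (psi : 'I_N.+1 -> {poly R}) (x : 'I_m -> R) : 'M[R]_(m, N.+1) :=
  \matrix_(j < m, k < N.+1) (psi k).[x j].

Definition sample_vector (R : realType) (m : nat) (f : R -> R) (x : 'I_m -> R)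
    : 'cV[R]_m :=
  \col_(j < m) f (x j).

Definition l1_feasible (R : realType) (m n : nat) (A : 'M[R]_(m, n))
    (y : 'cV[R]_m) (eta : R) : set 'cV[R]_n :=
  [set z | lpnorm 2 (A *m z - y) <= eta].

Definition is_l1_minimizer (R : realType) (m n : nat) (A : 'M[R]_(m, n))
    (y : 'cV[R]_m) (eta : R) (c : 'cV[R]_n) : Prop :=
  l1_feasible A y eta c /\
  forall z, l1_feasible A y eta z -> lpnorm 1 c <= lpnorm 1 z.

(* The set G need not be measurable a priori, hence the measurable subset E. *)
Definition with_prob_at_least (d : measure_display) (T : measurableType d)
    (R : realType) (P : probability T R) (r : R) (G : set T) : Prop :=
  exists E : set T, [/\ measurable E, E `<=` G & (r%:E <= P E)%E].

(* Main.v *)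
(** A polynomial p = sum_k c_k psi_k obeys |p| <= K ||c||_1 on [a, b], so the
    theorem is an l1 error bound for basis pursuit, and that follows from

      ||v||_2^2 <= 516 ||A v||_2^2 / m + ||v||_1^2 / (16 s)   for all v,      (1)

    a one-sided substitute for the restricted isometry property.

    To get (1) with high probability, normalize ||v||_1 = 1, let f = sum_k v_k psi_k
    and split |f| into the dyadic levels u_i = K / 2^(i+1), i < J ~ log s, plus a
    remainder below K / 2^J.  At level i, Maurey's empirical method replaces f by
    the average g of T_i ~ 4^i log s independent random +-psi_k, drawn with
    probabilities |v_k|: E_g measures {|g| > u_i / 2} well enough against
    {|f| > u_i} both in the mean and on the sample.  The remainder is truncated
    at K / 2^J <= K / s and needs a single net, of averages of about s log s terms.
    At level i there are only
    (2 (N + 1))^T_i such averages, so Chernoff bounds hold for all of them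
    simultaneously; they need only lower tails, for bounded nonnegative functions
    of one sample point. *)
Require Import Defs.
From mathcomp Require Import all_boot all_order all_algebra.
From mathcomp Require Import all_classical all_reals all_analysis.
From mathcomp Require Import measurable_realfun ring lra zify.

Set Implicit Arguments.
Unset Strict Implicit.
Unset Printing Implicit Defensive.

Import Order.TTheory GRing.Theory Num.Theory.
Import numFieldNormedType.Exports.

Local Open Scope classical_set_scope.
Local Open Scope ring_scope.

(** * Maurey's empirical method *)

(** The nets grow with the level but their cost does not. The union bound over the averages at level
    i costs [T_i log(N + 1) / m], and this enters with weight [u_i^2], proportional to [4^-i]. Each
    level thus pays about [K^2 log s log(N + 1) / m], and all levels together carry two logarithms
    of s. The third logarithm comes from the prescribed failure probability. The two passages
    between f and g are not symmetric. From f to g a constant factor may be lost, so Chebyshev's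
    inequality is enough. From g back to f the error is additive and has to end up below [1 / s], so
    an exponential tail is needed; this is the source of [log s] in [T_i]. That error is
    proportional to the sample mean of [sum_k |v_k| psi_k^2], and only here does an upper tail
    enter, for the [N + 1] functions [psi_k^2]. The factor [1 / (16 s)] in (1) becomes [1 / 4] after
    Cauchy-Schwarz on s coordinates, which is below the [1 / 2] at which the l1 cone argument stops
    working. *)

Lemma expR_le_quad (R : realType) (z : R) :
  `|z| <= 2^-1 -> expR z <= 1 + z + 2 * z ^+ 2.
Proof.
rewrite ler_norml => /andP[zl zu].
have h := expR_ge1Dx (- z).
have e0 := expR_gt0 z.
have eN : expR z * expR (- z) = 1 by rewrite -expRD subrr expR0.
have z1 : 0 < 1 - z by lra.
rewrite -(ler_pM2r z1) => {z1}.
apply: (@le_trans _ _ 1); first by rewrite -[leRHS]eN ler_pM2l.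
have : 0 <= z ^+ 2 * (1 - 2 * z) by rewrite mulr_ge0 ?sqr_ge0//; lra.
by lra.
Qed.

Lemma expR_subr1_le (R : realType) (x : R) : expR x - 1 <= x * expR x.
Proof.
have h := expR_ge1Dx (- x).
have eN : expR x * expR (- x) = 1 by rewrite -expRD subrr expR0.
have := expR_gt0 x; nra.
Qed.

Section iid_mean.
Context {R : realType} {I : finType}.
Implicit Types (w Y : I -> R) (G H : seq I -> R).

(** Expectation over T independent draws from the weights [w], written as a nested finite sum. No
    product space appears, and exchanging it with an integral or a sample average is plain
    linearity. *)
Fixpoint iid_mean w T G : R :=
  if T is T'.+1 then \sum_k w k * iid_mean w T' (fun l => G (k :: l))
  else G [::].

Lemma eq_iid_mean w T G H : (forall l, size l = T -> G l = H l) ->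
  iid_mean w T G = iid_mean w T H.
Proof.
elim: T G H => [|T IH] G H GH /=; first exact: GH.
by apply: eq_bigr => k _; congr (_ * _); apply: IH => l sl; apply: GH; rewrite /= sl.
Qed.

Lemma iid_meanD w T G H :
  iid_mean w T (fun l => G l + H l) = iid_mean w T G + iid_mean w T H.
Proof.
elim: T G H => [//|T IH] G H /=.
by rewrite -big_split; apply: eq_bigr => k _; rewrite IH mulrDr.
Qed.

Lemma iid_meanZ w T a G :
  iid_mean w T (fun l => a * G l) = a * iid_mean w T G.
Proof.
elim: T G => [//|T IH] G /=.
by rewrite mulr_sumr; apply: eq_bigr => k _; rewrite IH mulrCA.
Qed.

Lemma iid_mean_sum w T n (F : 'I_n -> seq I -> R) :
  iid_mean w T (fun l => \sum_j F j l) = \sum_j iid_mean w T (F j).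
Proof.
elim: T F => [//|T IH] F /=.
rewrite exchange_big /=; apply: eq_bigr => k _.
by rewrite IH mulr_sumr.
Qed.

Section weights.
Context (w : I -> R) (w_ge0 : forall k, 0 <= w k) (w1 : \sum_k w k = 1).

Lemma iid_mean_cst T a : iid_mean w T (fun=> a) = a.
Proof. by elim: T => //= T ->; rewrite -mulr_suml w1 mul1r. Qed.

Lemma iid_mean_le T G H : (forall l, size l = T -> G l <= H l) ->
  iid_mean w T G <= iid_mean w T H.
Proof.
elim: T G H => [|T IH] G H GH /=; first exact: GH.
by apply: ler_sum => k _; apply: ler_wpM2l => //; apply: IH => l sl; apply: GH; rewrite /= sl.
Qed.

Lemma iid_mean_big T Y :
  iid_mean w T (fun l => \sum_(k <- l) Y k) = T%:R * \sum_k w k * Y k.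
Proof.
elim: T => [|T IH] /=; first by rewrite big_nil mul0r.
under eq_bigr => k _.
  rewrite (@eq_iid_mean w T _ (fun l => Y k + \sum_(i <- l) Y i)); last first.
    by move=> l _; rewrite big_cons.
  rewrite iid_meanD iid_mean_cst IH mulrDr; over.
by rewrite big_split /= -mulr_suml w1 mul1r -natr1 mulrDl mul1r addrC.
Qed.

Lemma iid_mean_big_sqr T Y : \sum_k w k * Y k = 0 ->
  iid_mean w T (fun l => (\sum_(k <- l) Y k) ^+ 2)
  = T%:R * \sum_k w k * Y k ^+ 2.
Proof.
move=> Y0; elim: T => [|T IH] /=; first by rewrite big_nil expr0n mul0r.
under eq_bigr => k _.
  rewrite (@eq_iid_mean w T _ (fun l => Y k ^+ 2 +
     ((2 * Y k) * \sum_(i <- l) Y i + (\sum_(i <- l) Y i) ^+ 2))); last first.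
    by move=> l _; rewrite big_cons; ring.
  rewrite !iid_meanD iid_meanZ iid_mean_cst IH iid_mean_big Y0 mulr0 mulr0 add0r mulrDr.
  over.
by rewrite big_split /= -[X in _ + X]mulr_suml w1 mul1r -natr1 mulrDl mul1r addrC.
Qed.

Lemma iid_mean_expR T Y :
  iid_mean w T (fun l => expR (\sum_(k <- l) Y k))
  = (\sum_k w k * expR (Y k)) ^+ T.
Proof.
elim: T => [|T IH] /=; first by rewrite big_nil expR0.
rewrite exprS mulr_suml; apply: eq_bigr => k _; rewrite -mulrA; congr (_ * _).
by rewrite -IH -iid_meanZ; apply: eq_iid_mean => l _; rewrite big_cons expRD.
Qed.

End weights.
End iid_mean.

Section maurey.
Context {R : realType} {I : finType}.
Context (w : I -> R) (w_ge0 : forall k, 0 <= w k) (w1 : \sum_k w k = 1).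
Context (Y : I -> R).

Definition sample_mean (l : seq I) : R := (\sum_(k <- l) Y k) / (size l)%:R.

Let f := \sum_k w k * Y k.
Let V := \sum_k w k * Y k ^+ 2.

Let centered : \sum_k w k * (Y k - f) = 0.
Proof.
under eq_bigr do rewrite mulrBr.
by rewrite sumrB -mulr_suml w1 mul1r subrr.
Qed.

Let variance : \sum_k w k * (Y k - f) ^+ 2 = V - f ^+ 2.
Proof.
under eq_bigr => k _.
  rewrite (_ : _ * _ = w k * Y k ^+ 2 - 2 * f * (w k * Y k) + f ^+ 2 * w k).
    over.
  by ring.
rewrite big_split sumrB /= -!mulr_sumr w1 -/f -/V; ring.
Qed.

Let variance_le : \sum_k w k * (Y k - f) ^+ 2 <= V.
Proof. by rewrite variance gerBl sqr_ge0. Qed.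

Let sample_meanB T l : (0 < T)%N -> size l = T ->
  sample_mean l - f = (\sum_(k <- l) (Y k - f)) / T%:R.
Proof.
move=> T0 sl; rewrite /sample_mean sl sumrB mulrBl big_const_seq count_predT sl.
congr (_ - _); rewrite iter_addr_0 -[f *+ T]mulr_natr mulfK //.
by rewrite pnatr_eq0 -lt0n.
Qed.

Lemma sample_mean_variance T : (0 < T)%N ->
  iid_mean w T (fun l => (sample_mean l - f) ^+ 2) <= V / T%:R.
Proof.
move=> T0; have TR0 : (T%:R : R) != 0 by rewrite pnatr_eq0 -lt0n.
rewrite (@eq_iid_mean _ _ _ _ _ (fun l => (T%:R ^- 2) * (\sum_(k <- l) (Y k - f)) ^+ 2)).
  rewrite iid_meanZ iid_mean_big_sqr//.
  rewrite (_ : _ * _ = (\sum_k w k * (Y k - f) ^+ 2) / T%:R); last by field.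
  by rewrite ler_wpM2r// invr_ge0.
by move=> l /(sample_meanB T0) ->; field.
Qed.

Lemma sample_mean_sqr T : (0 < T)%N ->
  iid_mean w T (fun l => sample_mean l ^+ 2) <= f ^+ 2 + V / T%:R.
Proof.
move=> T0; have TR0 : (T%:R : R) != 0 by rewrite pnatr_eq0 -lt0n.
rewrite (@eq_iid_mean _ _ _ _ _ (fun l => (sample_mean l - f) ^+ 2 +
   (f ^+ 2 + (2 * f) * ((sample_mean l - f))))); last by move=> l _; ring.
rewrite !iid_meanD iid_mean_cst// iid_meanZ.
rewrite (_ : iid_mean w T (fun l => sample_mean l - f) = 0).
  by rewrite mulr0 addr0 addrC lerD2l sample_mean_variance.
rewrite (@eq_iid_mean _ _ _ _ _ (fun l => T%:R^-1 * (\sum_(k <- l) (Y k - f)))).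
  by rewrite iid_meanZ iid_mean_big// centered !mulr0.
by move=> l /(sample_meanB T0) ->; rewrite mulrC.
Qed.

Context (K : R) (K_gt0 : 0 < K) (YK : forall k, `|Y k| <= K).

Let f_le : `|f| <= K.
Proof.
apply: le_trans (ler_norm_sum _ _ _) _.
apply: le_trans (_ : \sum_k w k * K <= _); last by rewrite -mulr_suml w1 mul1r.
by apply: ler_sum => k _; rewrite normrM ger0_norm// ler_wpM2l.
Qed.

Lemma mean_sqr_le : V <= K ^+ 2.
Proof.
rewrite -[leRHS]mul1r -w1 mulr_suml; apply: ler_sum => k _.
by rewrite ler_wpM2l// -real_normK ?num_real// lerXn2r ?nnegrE// ltW.
Qed.

Lemma mean_sqr_ge0 : 0 <= V.
Proof. by apply: sumr_ge0 => k _; rewrite mulr_ge0// sqr_ge0. Qed.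

(** As [|Y k - f| <= 2 K], the exponent stays in [-1/2, 1/2], where [exp] is below a quadratic;
    centering kills the linear term. *)
Let exp_moment c : `|c| * K <= 4^-1 ->
  \sum_k w k * expR (c * (Y k - f)) <= expR (2 * c ^+ 2 * V).
Proof.
move=> cK.
apply: (@le_trans _ _ (1 + 2 * c ^+ 2 * \sum_k w k * (Y k - f) ^+ 2)); last first.
  apply: le_trans (expR_ge1Dx _); rewrite lerD2l ler_wpM2l//.
  by rewrite mulr_ge0// sqr_ge0.
rewrite (_ : 1 + _ = \sum_k w k * (1 + c * (Y k - f) + 2 * (c * (Y k - f)) ^+ 2)).
  apply: ler_sum => k _; rewrite ler_wpM2l// expR_le_quad//.
  rewrite normrM; apply: (@le_trans _ _ (`|c| * (K + K))).
    by rewrite ler_wpM2l// (le_trans (ler_normB _ _))// lerD.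
  by move: cK; lra.
under [RHS]eq_bigr => k _.
  rewrite (_ : _ * _ = w k + c * (w k * (Y k - f)) + 2 * c ^+ 2 * (w k * (Y k - f) ^+ 2)).
    over.
  by ring.
by rewrite !big_split /= -!mulr_sumr w1 centered mulr0 addr0.
Qed.

(* Markov's inequality for [cosh - 1] rather than [cosh]: the bound is then
   proportional to the second moment [V], which averages to 1 over the domain,
   so that no logarithm of [K] is lost. *)
Lemma sample_mean_tail T (u x : R) : (0 < T)%N -> 0 < u -> u <= K -> 2 <= x ->
  T%:R * u ^+ 2 = 64 * x * K ^+ 2 ->
  iid_mean w T (fun l => ((u / 4 <= `|sample_mean l - f|)%R)%:R)
  <= 2 * x * expR (- (x / 2)) * (V / K ^+ 2).
Proof.
move=> T0 u0 uK x2 Tu; have TR0 : 0 < (T%:R : R) by rewrite ltr0n.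
(* With this tilt a deviation of [u / 4] forces [|S l| >= x], while the exponential moment of [S] is
   at most [exp(x / 2 * V / K^2)], so half of the exponent survives. *)
pose c := u / (16 * K ^+ 2).
have K2 : 0 < K ^+ 2 by rewrite exprn_gt0.
have c0 : 0 < c by rewrite divr_gt0// mulr_gt0.
have cK : c * K <= 4^-1.
  rewrite (_ : c * K = u / K / 16); last by rewrite /c; field; rewrite gt_eqF.
  have : u / K <= 1 by rewrite ler_pdivrMr ?mul1r.
  by lra.
pose S l := \sum_(k <- l) c * (Y k - f).
pose H l := (expR (S l) + expR (- S l)) / 2 - 1.
(* Then [exp x / 2 - 1 >= exp x / 4]: subtracting 1 from [cosh] costs only a factor 2 in Markov's
   inequality. *)
have ex4 : 4 <= expR x.
  have e2 : 2 <= expR (x / 2).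
    by apply: le_trans (expR_ge1Dx _); lra.
  have -> : expR x = expR (x / 2) * expR (x / 2) by rewrite -expRD -splitr.
  have -> : 4 = 2 * 2 :> R by ring.
  by rewrite ler_pM.
have markov l : size l = T ->
    ((u / 4 <= `|sample_mean l - f|)%R)%:R <= 4 * expR (- x) * H l.
  move=> sl; have eN : expR (S l) * expR (- S l) = 1 by rewrite -expRD subrr expR0.
  have ep := expR_gt0 (S l); have en := expR_gt0 (- S l).
  have H0 : 0 <= H l.
    have := mulr_ge0 (ltW en) (sqr_ge0 (expR (S l) - 1)).
    rewrite (_ : _ * _ = expR (S l) * (expR (S l) * expR (- S l))
      - 2 * (expR (S l) * expR (- S l)) + expR (- S l)); last by ring.
    by rewrite eN /H; lra.
  case: (leP (u / 4)) => [ge|_]; last by rewrite mulr_ge0// mulr_ge0// expR_ge0.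
  have xS : x <= `|S l|.
    have -> : S l = c * T%:R * (sample_mean l - f).
      by rewrite (sample_meanB T0 sl) /S -mulr_sumr; field; rewrite gt_eqF.
    rewrite normrM ger0_norm; last by rewrite mulr_ge0// ltW.
    apply: le_trans (_ : c * T%:R * (u / 4) <= _); last by rewrite ler_wpM2l// mulr_ge0// ltW.
    rewrite (_ : _ * _ = (T%:R * u ^+ 2) / (64 * K ^+ 2)).
      by rewrite Tu le_eqVlt; apply/orP; left; apply/eqP; field; rewrite gt_eqF.
    by rewrite /c; field; rewrite gt_eqF.
  have : expR x <= expR (S l) + expR (- S l).
    have : expR x <= expR `|S l| by rewrite ler_expR.
    by case: (ger0P (S l)) => _; lra.
  have eNx : expR x * expR (- x) = 1 by rewrite -expRD subrr expR0.
  have enx := expR_gt0 (- x).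
  by rewrite /H /=; nra.
apply: le_trans (iid_mean_le w_ge0 markov) _.
rewrite iid_meanZ.
have mH : iid_mean w T H <= expR (x / 2 * (V / K ^+ 2)) - 1.
  rewrite (@eq_iid_mean _ _ _ _ _ (fun l => 2^-1 * expR (\sum_(k <- l) (c * (Y k - f))) +
    (2^-1 * expR (\sum_(k <- l) (- c * (Y k - f))) + -1))); last first.
    move=> l _; rewrite (_ : \sum_(k <- l) (- c * (Y k - f)) = - S l).
      by rewrite /H /S; field.
    by rewrite /S -!mulr_sumr mulNr.
  rewrite !iid_meanD !iid_meanZ iid_mean_cst// !iid_mean_expR.
  have A : (expR (2 * c ^+ 2 * V)) ^+ T = expR (x / 2 * (V / K ^+ 2)).
    rewrite -expRM_natl -mulr_natl; congr expR.
    rewrite (_ : _ * _ = (T%:R * u ^+ 2) * (V / (128 * K ^+ 4))).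
      by rewrite Tu; field; rewrite gt_eqF.
    by rewrite /c; field; rewrite gt_eqF.
  have B d : `|d| = c -> (\sum_k w k * expR (d * (Y k - f))) ^+ T <= expR (x / 2 * (V / K ^+ 2)).
    move=> dc; rewrite -A lerXn2r ?nnegrE ?expR_ge0//.
      by apply: sumr_ge0 => k _; rewrite mulr_ge0// expR_ge0.
    have -> : c ^+ 2 = d ^+ 2 by rewrite -dc real_normK ?num_real.
    by apply: exp_moment; rewrite dc.
  have := B c (gtr0_norm c0); have := B (- c); rewrite normrN gtr0_norm// => /(_ erefl).
  lra.
have V0 := mean_sqr_ge0.
have VK : V / K ^+ 2 <= 1 by rewrite ler_pdivrMr// mul1r mean_sqr_le.
have VK0 : 0 <= V / K ^+ 2 by rewrite divr_ge0// ltW.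
(* The inequality [exp t - 1 <= t exp t] brings out the factor [V / K^2]. *)
have : expR (x / 2 * (V / K ^+ 2)) - 1 <= x / 2 * (V / K ^+ 2) * expR (x / 2).
  apply: le_trans (expR_subr1_le _) _; rewrite ler_wpM2l//.
    by rewrite mulr_ge0//; lra.
  by rewrite ler_expR; nra.
move=> le2; apply: le_trans (ler_wpM2l _ (le_trans mH le2)) _.
  by rewrite mulr_ge0// expR_ge0.
have -> : expR (- x) = expR (- (x / 2)) * expR (- (x / 2)).
  by rewrite -expRD; congr expR; field.
have eN : expR (x/2) * expR (- (x/2)) = 1 by rewrite -expRD subrr expR0.
rewrite le_eqVlt; apply/orP; left; apply/eqP.
transitivity ((expR (x / 2) * expR (- (x / 2))) * (2 * x * expR (- (x / 2)) * (V / K ^+ 2))).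
  by field; rewrite gt_eqF.
by rewrite eN mul1r.
Qed.

End maurey.

(** * Integration against weighted laws *)

Section transfer.

Import HBNNSimple.

Section weighted_integral.
Context d d' {T : measurableType d} {U : measurableType d'} {R : realType}.
Context (mu : {measure set T -> \bar R}) (X : T -> U) (g : T -> R).
Context (mX : measurable_fun setT X) (mg : measurable_fun setT g)
  (g_ge0 : forall x, 0 <= g x).

Lemma weighted_integral_nnsfun (h : {nnsfun U >-> R}) :
  (\int[mu]_x (g x * h (X x))%:E =
   \sum_(y \in range h)
      y%:E * \int[mu]_x (g x * \1_(h @^-1` [set y]) (X x))%:E)%E.
Proof.
transitivity (\int[mu]_x (\sum_(y \in range h)
   (g x * (y * \1_(h @^-1` [set y]) (X x)))%:E))%E.
  apply: eq_integral => x _; rewrite [in LHS]fimfunE.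
  rewrite EFinM -fsumEFin// ge0_mule_fsumr// => y.
  exact: (nnfun_muleindic_ge0 h y (X x)).
have mI y : measurable_fun setT (fun x => \1_(h @^-1` [set y]) (X x) : R).
  by apply: (measurableT_comp (measurable_indic _) mX).
rewrite ge0_integral_fsum//; last 2 first.
- move=> y; apply/measurable_EFinP; apply: measurable_funM => //.
  exact: measurable_funM.
- move=> y x _; rewrite EFinM mule_ge0 ?lee_fin//.
  exact: (nnfun_muleindic_ge0 h y (X x)).
apply: eq_fsbigr => y /set_mem[u _ <-].
under eq_integral do rewrite mulrCA EFinM.
rewrite ge0_integralZl//.
- by apply/measurable_EFinP; exact: measurable_funM.
- by move=> x _; rewrite lee_fin mulr_ge0.
- by rewrite lee_fin.
Qed.

Lemma weighted_integral_lim (F : U -> R) (mF : measurable_fun setT F) :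
  (forall u, 0 <= F u) ->
  let h := nnsfun_approx measurableT (proj2 (measurable_EFinP _ _) mF) in
  (\int[mu]_x (g x * F (X x))%:E =
   limn (fun n => \int[mu]_x (g x * h n (X x))%:E))%E.
Proof.
move=> F0 h.
rewrite -monotone_convergence//.
- apply: eq_integral => x _; apply/esym/cvg_lim => //.
  rewrite EFinM; under eq_fun do rewrite EFinM.
  apply: cvgeZl => //.
  by apply: cvg_nnsfun_approx => // u _; rewrite lee_fin.
- move=> n; apply/measurable_EFinP; apply: measurable_funM => //.
  exact: (measurableT_comp (f := h n)).
- by move=> n x _; rewrite lee_fin mulr_ge0.
- move=> x _ m n mn; rewrite lee_fin ler_wpM2l//.
  by have /lefP := nd_nnsfun_approx measurableT (proj2 (measurable_EFinP _ _) mF) mn; apply.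
Qed.

End weighted_integral.

(** The passage from indicators to simple functions to monotone limits, done once for weighted laws.
    It serves the change of variables (weights 1), the density of the samples (weight [nu]), and
    independence (weight the product of the other coordinates). *)
Lemma ge0_integral_transfer d1 d2 d' (T1 : measurableType d1)
    (T2 : measurableType d2) (U : measurableType d') (R : realType)
    (mu1 : {measure set T1 -> \bar R}) (mu2 : {measure set T2 -> \bar R})
    (X1 : T1 -> U) (X2 : T2 -> U) (g1 : T1 -> R) (g2 : T2 -> R) (F : U -> R) :
  measurable_fun setT X1 -> measurable_fun setT X2 ->
  measurable_fun setT g1 -> measurable_fun setT g2 ->
  (forall x, 0 <= g1 x) -> (forall x, 0 <= g2 x) ->
  measurable_fun setT F -> (forall u, 0 <= F u) ->
  (forall B, measurable B ->
     \int[mu1]_x (g1 x * \1_B (X1 x))%:E = \int[mu2]_x (g2 x * \1_B (X2 x))%:E)%E ->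
  (\int[mu1]_x (g1 x * F (X1 x))%:E = \int[mu2]_x (g2 x * F (X2 x))%:E)%E.
Proof.
move=> mX1 mX2 mg1 mg2 g10 g20 mF F0 H.
rewrite (weighted_integral_lim mu1 mX1 mg1 g10 mF F0).
rewrite (weighted_integral_lim mu2 mX2 mg2 g20 mF F0).
set h := nnsfun_approx _ _.
suff -> : (fun n => \int[mu1]_x (g1 x * h n (X1 x))%:E)%E =
          (fun n => \int[mu2]_x (g2 x * h n (X2 x))%:E)%E by [].
apply/funext => n; rewrite !weighted_integral_nnsfun//.
by apply: eq_fsbigr => y _; rewrite H//.
Qed.

End transfer.

(** * Bounded measurable functions and independence *)

Section bounded_measurable.
Context d {U : measurableType d} {R : realType}.
Implicit Types F G : U -> R.

(** A class closed under all the operations used below and integrable for every probability, so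
    integrability reduces to closure properties. *)
Definition bmeas F := measurable_fun setT F /\ exists M : R, forall x, `|F x| <= M.

Lemma bmeas_cst c : bmeas (fun=> c).
Proof. by split; [exact: measurable_cst|exists `|c|]. Qed.

Lemma bmeasD F G : bmeas F -> bmeas G -> bmeas (fun x => F x + G x).
Proof.
move=> [mF [M FM]] [mG [N GN]]; split; first exact: measurable_funD.
by exists (M + N) => x; rewrite (le_trans (ler_normD _ _))// lerD.
Qed.

Lemma bmeasM F G : bmeas F -> bmeas G -> bmeas (fun x => F x * G x).
Proof.
move=> [mF [M FM]] [mG [N GN]]; split; first exact: measurable_funM.
by exists (M * N) => x; rewrite normrM ler_pM.
Qed.

Lemma bmeasX F n : bmeas F -> bmeas (fun x => F x ^+ n).
Proof.
move=> bF; elim: n => [|n IH]; first exact: bmeas_cst.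
by under eq_fun do rewrite exprS; exact: bmeasM.
Qed.

Lemma bmeas_sum (I : Type) (r : seq I) (F : I -> U -> R) :
  (forall i, bmeas (F i)) -> bmeas (fun x => \sum_(i <- r) F i x).
Proof.
move=> bF; elim: r => [|i r IH].
  by under eq_fun do rewrite big_nil; exact: bmeas_cst.
by under eq_fun do rewrite big_cons; exact: bmeasD.
Qed.

Lemma bmeas_min F c : bmeas F -> bmeas (fun x => Num.min (F x) c).
Proof.
move=> [mF [M FM]]; split.
  by apply: measurable_minr => //; exact: measurable_cst.
exists (M + `|c|) => x; have := FM x; have := normr_ge0 c; have := normr_ge0 (F x).
by rewrite minEle; case: ifP; lra.
Qed.

Lemma bmeas_gt_norm F u : bmeas F -> bmeas (fun x => ((u < `|F x|)%R)%:R).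
Proof.
move=> [mF _]; split; last by exists 1 => x; case: (_ < _); rewrite ?normr1 ?normr0.
pose B := [set x | u < `|F x|].
rewrite (_ : (fun x => _) = \1_B); last first.
  by apply/funext => x; rewrite indicE /B; congr (nat_of_bool _)%:R; apply/idP/idP; rewrite inE.
apply: measurable_indic; rewrite -[B]setTI.
have : measurable_fun setT (fun x => u < `|F x|).
  by apply: measurable_fun_ltr => //; exact: measurableT_comp.
by move=> /(_ measurableT [set true]); apply.
Qed.

Lemma bmeas_expR F : bmeas F -> bmeas (fun x => expR (F x)).
Proof.
move=> [mF [M FM]]; split; first exact: measurableT_comp.
exists (expR M) => x; rewrite ger0_norm ?expR_ge0// ler_expR.
by rewrite (le_trans _ (FM x))// ler_norm.
Qed.

Lemma bmeas_integrable (Q : probability U R) F : bmeas F ->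
  Q.-integrable setT (EFin \o F).
Proof.
move=> [mF [M FM]]; apply: measurable_bounded_integrable => //.
  exact: (le_lt_trans (probability_le1 Q measurableT) (ltry _)).
exists M; split; first exact: num_real.
by move=> x xM y _; exact: (le_trans (FM y) (ltW xM)).
Qed.

Section mean.
Context (Q : probability U R).

Definition mean F : R := \int[Q]_x F x.

Lemma mean_fineK F : bmeas F -> (\int[Q]_x (F x)%:E)%E = (mean F)%:E.
Proof.
by move=> /(bmeas_integrable Q) iF; rewrite fineK//; apply: integrable_fin_num.
Qed.

Lemma meanD F G : bmeas F -> bmeas G ->
  mean (fun x => F x + G x) = mean F + mean G.
Proof.
by move=> /(bmeas_integrable Q) iF /(bmeas_integrable Q) iG; rewrite /mean RintegralD.
Qed.

Lemma meanZ c F : bmeas F -> mean (fun x => c * F x) = c * mean F.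
Proof. by move=> /(bmeas_integrable Q) iF; rewrite /mean RintegralZl. Qed.

Lemma mean_cst c : mean (fun=> c) = c.
Proof.
rewrite /mean Rintegral_cst// -[RHS]mulr1; congr (_ * _).
exact: (congr1 fine (probability_setT Q)).
Qed.

Lemma mean_le F G : bmeas F -> bmeas G -> (forall x, F x <= G x) ->
  mean F <= mean G.
Proof.
by move=> /(bmeas_integrable Q) iF /(bmeas_integrable Q) iG FG; rewrite /mean le_Rintegral.
Qed.

Lemma mean_sum (I : Type) (r : seq I) (F : I -> U -> R) :
  (forall i, bmeas (F i)) ->
  mean (fun x => \sum_(i <- r) F i x) = \sum_(i <- r) mean (F i).
Proof.
move=> bF; elim: r => [|i r IH].
  by rewrite big_nil; under [X in mean X]eq_fun do rewrite big_nil; exact: mean_cst.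
rewrite big_cons; under [X in mean X]eq_fun do rewrite big_cons.
by rewrite meanD ?IH//; exact: bmeas_sum.
Qed.

End mean.
End bounded_measurable.

Section independence.
Context d {T : measurableType d} {R : realType} (P : probability T R).
Context (m : nat) (X : 'I_m -> {RV P >-> R}) (indep : mutually_independent X).

Let good (G : 'I_m -> R -> R) :=
  (\int[P]_w (\prod_j G j (X j w))%:E)%E = (\prod_j mean P (G j \o X j))%:E.

Let bm_comp j (G : R -> R) : bmeas G -> bmeas (G \o X j).
Proof.
by move=> [mG [M GM]]; split; [apply: measurableT_comp|exists M => x; exact: GM].
Qed.

Let mean_indic j (B : set R) : measurable B -> (mean P (\1_B \o X j))%:E = P (X j @^-1` B).
Proof.
move=> mB; rewrite -mean_fineK; last first.
  apply: bm_comp; split; first exact: measurable_indic.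
  by exists 1 => x; rewrite indicE; case: (_ \in _); rewrite ?normr1 ?normr0.
rewrite -[X in P X]setIT.
have mA : measurable (X j @^-1` B).
  by rewrite -[X in measurable X]setTI; exact: measurable_funP.
exact: (integral_indic P measurableT mA).
Qed.

Let bmeas_prod (I : Type) (r : seq I) (p : pred I) (F : I -> T -> R) :
  (forall i, bmeas (F i)) -> bmeas (fun x => \prod_(i <- r | p i) F i x).
Proof.
move=> bF; elim: r => [|i r IH].
  by under eq_fun do rewrite big_nil; exact: bmeas_cst.
by under eq_fun do rewrite big_cons; case: (p i) => //; exact: bmeasM.
Qed.

Let prod_indic (B : 'I_m -> set R) : (forall j, measurable (B j)) ->
  good (fun j => \1_(B j)).
Proof.
move=> mB; rewrite /good.
have := indep [set: 'I_m]%SET mB.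
rewrite (_ : \prod_(j in _) _ = (\prod_j mean P (\1_(B j) \o X j))%:E)%E; last first.
  rewrite -prodEFin; apply: eq_big => [j|j _]; first by rewrite inE.
  by rewrite mean_indic.
move=> <-; rewrite -[X in P X]setIT.
have mA : measurable (\bigcap_(j in [set` [set: 'I_m]%SET]) (X j @^-1` B j)).
  apply: fin_bigcap_measurable => // j _.
  by rewrite -[X in measurable X]setTI; exact: measurable_funP.
have <- := integral_indic P measurableT mA.
apply: eq_integral => w _; congr (_%:E).
rewrite indicE; have [/set_mem wB|wB] := boolP (w \in _).
  by rewrite big1// => j _; rewrite indicE mem_set//; apply: (wB j); rewrite /= inE.
have [j jB] : exists j, ~ B j (X j w).
  apply/existsNP => H; move/negP: wB; apply; rewrite inE => j _; exact: H.
by rewrite (bigD1 j)//= indicE memNset// mul0r.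
Qed.

(* The indicator of independence is replaced by [G j] one coordinate at a
   time, the other coordinates acting as a weight on [P]. *)
Let good_seq (s : seq 'I_m) (G : 'I_m -> R -> R) :
  (forall j, bmeas (G j)) -> (forall j x, 0 <= G j x) ->
  (forall j, j \notin s -> exists2 B, measurable B & G j = \1_B) -> good G.
Proof.
elim: s G => [|i s IH] G bG G0 Gs.
  have Gi j : exists B, measurable B /\ G j = \1_B.
    by have [B mB GB] := Gs j isT; exists B.
  have [B BP] := choice Gi.
  rewrite (_ : G = fun j => \1_(B j)); last by apply/funext => j; case: (BP j).
  by apply: prod_indic => j; case: (BP j).
have bGX j : bmeas (G j \o X j) by exact: bm_comp.
pose g w := \prod_(j | j != i) G j (X j w).
pose c := \prod_(j | j != i) mean P (G j \o X j).
have c0 : 0 <= c by apply: prodr_ge0 => j _; apply: Rintegral_ge0 => w _; exact: G0.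
have bg : bmeas g by apply: bmeas_prod.
rewrite /good; under eq_integral do rewrite (bigD1 i)//= mulrC -/(g _).
rewrite (@ge0_integral_transfer _ _ _ _ _ _ _ P P (X i) (X i) g (cst c))//.
- transitivity ((mean P (fun w => c * (G i \o X i) w))%:E).
    exact: (mean_fineK P (bmeasM (bmeas_cst c) (bGX i))).
  by rewrite (bigD1 i)//= -/c [in RHS]mulrC; congr (_%:E); exact: (meanZ P c (bGX i)).
- by case: bg.
- by move=> w; apply: prodr_ge0.
- by case: (bG i).
move=> B mB.
have b1 : bmeas (\1_B : R -> R).
  split; first exact: measurable_indic.
  by exists 1 => x; rewrite indicE; case: (_ \in _); rewrite ?normr1 ?normr0.
pose G' (j : 'I_m) := if j == i then \1_B else G j.
have gG' : good G'.
  apply: IH => [j|j x|j js]; rewrite /G'; first by case: eqP.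
    by case: eqP => // _; rewrite indicE.
  case: eqP => [_|/eqP ji]; first by exists B.
  by apply: Gs; rewrite inE negb_or ji.
have G'i : G' i = \1_B by rewrite /G' eqxx.
transitivity (\int[P]_w (\prod_j G' j (X j w))%:E)%E.
  apply: eq_integral => w _; rewrite (bigD1 i)//= mulrC G'i; congr (_ * _)%:E.
  by apply: eq_bigr => j /negbTE ji; rewrite /G' ji.
rewrite [LHS]gG' (bigD1 i)//= G'i.
rewrite (_ : \prod_(j | j != i) _ = c); last first.
  by apply: eq_bigr => j /negbTE ji; rewrite /G' ji.
rewrite mulrC -meanZ; last exact: bm_comp.
by rewrite -mean_fineK//; apply: bmeasM; [exact: bmeas_cst|exact: bm_comp].
Qed.

Lemma mean_indep_prod (G : 'I_m -> R -> R) :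
  (forall j, bmeas (G j)) -> (forall j x, 0 <= G j x) ->
  (\int[P]_w (\prod_j G j (X j w))%:E)%E = (\prod_j mean P (G j \o X j))%:E.
Proof.
by move=> bG G0; apply: (@good_seq (enum 'I_m)) => // j; rewrite mem_enum.
Qed.

End independence.

(** * Concentration *)

Lemma expR_oppr_le (R : realType) (z : R) :
  0 <= z -> z <= 1 -> expR (- z) <= 1 - z / 2.
Proof.
move=> z0 z1; have h := expR_ge1Dx z.
have z1' : 0 < 1 + z by lra.
rewrite -(ler_pM2r z1'); apply: (@le_trans _ _ 1).
  have eN : expR (- z) * expR z = 1 by rewrite -expRD addNr expR0.
  by rewrite -[leRHS]eN ler_pM2l ?expR_gt0.
have : 0 <= z * (1 - z) by rewrite mulr_ge0//; lra.
by lra.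
Qed.

Lemma expR_le_lin (R : realType) (z : R) :
  0 <= z -> z <= 2^-1 -> expR z <= 1 + 2 * z.
Proof.
move=> z0 z1; apply: le_trans (expR_le_quad _) _; first by rewrite ger0_norm.
have : 0 <= z * (1 - 2 * z) by rewrite mulr_ge0//; lra.
by lra.
Qed.

Lemma measurable_lt_bmeas d (U : measurableType d) (R : realType) (F G : U -> R) :
  bmeas F -> bmeas G -> measurable [set x | F x < G x].
Proof.
move=> [mF _] [mG _]; rewrite -[X in measurable X]setTI.
by have := measurable_fun_ltr mF mG measurableT (Y := [set true]) I; apply.
Qed.

Definition emp (R : realType) (m : nat) (F : R -> R) (y : 'I_m -> R) : R :=
  (\sum_j F (y j)) / m%:R.

Section concentration.
Context d {T : measurableType d} {R : realType} (P : probability T R).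
Context (m : nat) (X : 'I_m -> {RV P >-> R}) (indep : mutually_independent X).
Context (Q : probability R R).
Context (law : forall j B, measurable B -> P (X j @^-1` B) = Q B).

Lemma mean_law j (F : R -> R) : bmeas F -> (forall x, 0 <= F x) ->
  mean P (F \o X j) = mean Q F.
Proof.
move=> [mF _] F0; rewrite /mean /Rintegral; congr fine.
have := @ge0_integral_transfer _ _ _ _ _ _ _ P Q (X j) id (cst 1) (cst 1) F.
under eq_integral do rewrite /= mul1r; under [in RHS]eq_integral do rewrite /= mul1r.
apply=> //.
move=> B mB.
have mXB : measurable (X j @^-1` B).
  by rewrite -[X in measurable X]setTI; exact: measurable_funP.
transitivity (\int[P]_w (\1_(X j @^-1` B) w)%:E)%E.
  by apply: eq_integral => w _; rewrite /= mul1r.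
transitivity (\int[Q]_x (\1_B x)%:E)%E; last first.
  by apply: eq_integral => w _; rewrite /= mul1r.
rewrite (integral_indic P measurableT mXB) (integral_indic Q measurableT mB).
by rewrite !setIT; exact: law.
Qed.

Lemma bmeas_emp (F : R -> R) : bmeas F -> bmeas (fun w => emp F (X^~ w)).
Proof.
move=> [mF [M FM]].
have bF j : bmeas (F \o X j).
  by split; [exact: measurableT_comp|exists M => x; exact: FM].
rewrite /emp; under eq_fun do rewrite mulrC.
by apply: bmeasM; [exact: bmeas_cst|exact: bmeas_sum].
Qed.

(** Markov's inequality for the product of the [exp(S(X j))], whose mean factorizes by independence
    and is at most [exp(m kappa)]. *)
Lemma chernoff (S : R -> R) kappa tau (A : set T) : bmeas S -> measurable A ->
  mean Q (fun x => expR (S x)) <= expR kappa ->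
  (forall w, A w -> m%:R * kappa + tau <= \sum_j S (X j w)) ->
  (P A <= (expR (- tau))%:E)%E.
Proof.
move=> bS mA Sk AS.
have bE : bmeas (fun x => expR (S x)) by exact: bmeas_expR.
have int := mean_indep_prod indep (fun=> bE) (fun _ _ => expR_ge0 _).
have bEX j : bmeas ((fun x => expR (S x)) \o X j).
  by case: bE => mE [M EM]; split; [exact: measurableT_comp|exists M => x; exact: EM].
pose c := expR (m%:R * kappa + tau).
have : (c%:E * P A <= (expR (m%:R * kappa))%:E)%E.
  apply: (@le_trans _ _ (\int[P]_w (\prod_j expR (S (X j w)))%:E)%E); last first.
    rewrite int lee_fin expRM_natl -[m in leRHS]card_ord -prodr_const.
    apply: ler_prod => j _; rewrite mean_law//.
    by rewrite Sk andbT; apply: Rintegral_ge0 => x _; exact: expR_ge0.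
  have mA' := integral_indic P measurableT mA; rewrite setIT in mA'.
  rewrite -mA' -ge0_integralZl//; last 2 first.
  - by apply/measurable_EFinP; exact: measurable_indic.
  - by rewrite lee_fin expR_ge0.
  apply: ge0_le_integral => //.
  - by move=> w _; rewrite mule_ge0 ?lee_fin ?expR_ge0.
  - apply/measurable_EFinP; apply: measurable_funM; first exact: measurable_cst.
    exact: measurable_indic.
  - by apply/measurable_EFinP; apply: measurable_prod => j _; case: (bEX j).
  - move=> w _; rewrite -EFinM lee_fin indicE.
    have [wA|_] := boolP (w \in A); last first.
      by rewrite mulr0; apply: prodr_ge0 => j _; exact: expR_ge0.
    by rewrite mulr1 -expR_sum ler_expR; apply: AS; rewrite inE in wA.
rewrite -(fineK (fin_num_measure P A mA)) -EFinM !lee_fin /c expRD => h.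
rewrite -(ler_pM2l (expR_gt0 (m%:R * kappa))) -(ler_pM2l (expR_gt0 tau)).
rewrite mulrA (mulrC (expR tau)); apply: (le_trans h).
by rewrite mulrCA -expRD subrr expR0 mulr1.
Qed.

(** Tilting by [- F / B] and using [exp(-z) <= 1 - z / 2] on [0, 1] makes the exponential moment at
    most [exp(- mean F / (2 B))]. Giving up a factor 2 leaves an additive loss linear in
    [B tau / m], with no variance term. *)
Lemma lower_tail (F : R -> R) (B tau : R) : (0 < m)%N -> bmeas F -> 0 < B ->
  (forall x, 0 <= F x) -> (forall x, F x <= B) ->
  (P [set w | (2 * emp F (X^~ w) + 2 * B * tau / m%:R < mean Q F)%R]
   <= (expR (- tau))%:E)%E.
Proof.
move=> m0 bF B0 F0 FB; have mR : 0 < (m%:R : R) by rewrite ltr0n.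
have bS : bmeas (fun x => - B^-1 * F x) by apply: bmeasM => //; exact: bmeas_cst.
apply: (@chernoff (fun x => - B^-1 * F x) (- (mean Q F / (2 * B)))) => //.
- apply: measurable_lt_bmeas; last exact: bmeas_cst.
  apply: bmeasD; last exact: bmeas_cst.
  by apply: bmeasM; [exact: bmeas_cst|exact: bmeas_emp].
- apply: le_trans (expR_ge1Dx _).
  apply: (@le_trans _ _ (mean Q (fun x => 1 + (- (2 * B)^-1) * F x))).
    apply: mean_le; first exact: bmeas_expR.
      apply: bmeasD; first exact: bmeas_cst.
      by apply: bmeasM => //; exact: bmeas_cst.
    move=> x; have FB1 : F x / B <= 1 by rewrite ler_pdivrMr// mul1r.
    rewrite mulNr (mulrC B^-1).
    apply: le_trans (expR_oppr_le (divr_ge0 (F0 x) (ltW B0)) FB1) _.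
    by rewrite le_eqVlt; apply/orP; left; apply/eqP; field; rewrite gt_eqF.
  rewrite meanD; [|exact: bmeas_cst|by apply: bmeasM => //; exact: bmeas_cst].
  by rewrite mean_cst meanZ// mulNr (mulrC _ (mean Q F)).
- move=> w /=; rewrite /emp -mulr_sumr; set S := \sum_j _ => h.
  have : 2 * S + 2 * B * tau < mean Q F * m%:R.
    by rewrite -ltr_pdivrMr//; congr (_ < _) : h; field; rewrite gt_eqF.
  move=> {}h; rewrite -(ler_pM2r (_ : 0 < 2 * B)) ?mulr_gt0//.
  rewrite (_ : _ * (2 * B) = - (mean Q F * m%:R) + 2 * B * tau); last first.
    by field; rewrite gt_eqF.
  rewrite (_ : - B^-1 * S * (2 * B) = - 2 * S); last by field; rewrite gt_eqF.
  lra.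
Qed.

Lemma upper_tail (F : R -> R) (B tau : R) : (0 < m)%N -> bmeas F -> 0 < B ->
  (forall x, 0 <= F x) -> (forall x, F x <= B) ->
  (P [set w | (2 * mean Q F + 2 * B * tau / m%:R < emp F (X^~ w))%R]
   <= (expR (- tau))%:E)%E.
Proof.
move=> m0 bF B0 F0 FB; have mR : 0 < (m%:R : R) by rewrite ltr0n.
have bS : bmeas (fun x => (2 * B)^-1 * F x) by apply: bmeasM => //; exact: bmeas_cst.
apply: (@chernoff (fun x => (2 * B)^-1 * F x) (mean Q F / B)) => //.
- apply: measurable_lt_bmeas; first exact: bmeas_cst.
  exact: bmeas_emp.
- apply: le_trans (expR_ge1Dx _).
  apply: (@le_trans _ _ (mean Q (fun x => 1 + B^-1 * F x))).
    apply: mean_le; first exact: bmeas_expR.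
      apply: bmeasD; first exact: bmeas_cst.
      by apply: bmeasM => //; exact: bmeas_cst.
    move=> x; rewrite (mulrC (2 * B)^-1).
    have FB1 : F x / (2 * B) <= 2^-1.
      rewrite ler_pdivrMr ?mulr_gt0// (_ : 2^-1 * (2 * B) = B)//; by field.
    have B2 : 0 <= 2 * B by rewrite mulr_ge0// ltW.
    apply: le_trans (expR_le_lin (divr_ge0 (F0 x) B2) FB1) _.
    by rewrite le_eqVlt; apply/orP; left; apply/eqP; field; rewrite gt_eqF.
  rewrite meanD; [|exact: bmeas_cst|by apply: bmeasM => //; exact: bmeas_cst].
  by rewrite mean_cst meanZ// (mulrC _ (mean Q F)).
- move=> w /=; rewrite /emp -mulr_sumr; set S := \sum_j _ => h.
  have : mean Q F * 2 * m%:R + 2 * B * tau < S.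
    by rewrite -(ltr_pM2r mR) in h; rewrite divfK ?gt_eqF// in h; congr (_ < _) : h; field; rewrite gt_eqF.
  move=> {}h; rewrite -(ler_pM2r (_ : 0 < 2 * B)) ?mulr_gt0//.
  rewrite (_ : _ * (2 * B) = mean Q F * 2 * m%:R + 2 * B * tau); last first.
    by field; rewrite gt_eqF.
  rewrite (_ : (2 * B)^-1 * S * (2 * B) = S); last by field; rewrite gt_eqF.
  lra.
Qed.

End concentration.

(** * Dyadic levels *)

Section dyadic.
Context {R : realType}.
Implicit Types (K t B : R).

Definition level K i : R := K / 2 ^+ i.+1.

Lemma level_gt0 K i : 0 < K -> 0 < level K i.
Proof. by move=> K0; rewrite divr_gt0// exprn_gt0. Qed.

Lemma level_ge0 K i : 0 <= K -> 0 <= level K i.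
Proof. by move=> K0; rewrite divr_ge0// exprn_ge0. Qed.

Lemma level_sqr K i : level K i ^+ 2 = K ^+ 2 / 4 ^+ i.+1.
Proof.
rewrite /level exprMn exprVn -exprM mulnC exprM.
by congr (_ / _ ^+ _); ring.
Qed.

Lemma levelS K i : level K i = 2 * level K i.+1.
Proof.
rewrite /level [in RHS]exprS; field.
by rewrite expf_neq0// pnatr_eq0.
Qed.

(** With [u = level K J], lowering the truncation of [t^2] from [4 u^2] to [u^2] loses something
    only if [|t| > u], and then at most [4 u^2]. The induction starts at the harmless truncation
    [K^2]. *)
Lemma layer_cake K t J : `|t| <= K ->
  t ^+ 2 <= Num.min (t ^+ 2) (K ^+ 2 / 4 ^+ J)
    + 4 * \sum_(i < J) level K i ^+ 2 * ((level K i < `|t|)%R)%:R.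
Proof.
move=> tK; have K0 : 0 <= K by exact: le_trans tK.
have t2 : t ^+ 2 = `|t| ^+ 2 by rewrite real_normK ?num_real.
elim: J => [|J IH].
  rewrite big_ord0 mulr0 addr0 divr1 le_min lexx/= t2.
  by rewrite lerXn2r ?nnegrE.
apply: (le_trans IH); rewrite big_ord_recr/= mulrDr addrA addrAC lerD2r.
rewrite (_ : K ^+ 2 / 4 ^+ J = 4 * level K J ^+ 2); last first.
  by rewrite level_sqr (exprS 4); field; rewrite expf_neq0// pnatr_eq0.
rewrite -level_sqr; have := level_ge0 J K0; move: (level K J) => u u0.
rewrite t2; have t0 := normr_ge0 t; case: ltP => [ut|tu].
  rewrite mulr1; apply: (@le_trans _ _ (4 * u ^+ 2)).
    by rewrite ge_min lexx orbT.
  by rewrite lerDr le_min !sqr_ge0.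
rewrite mulr0 mulr0 addr0 le_min !ge_min lexx/=.
by rewrite lerXn2r ?nnegrE.
Qed.

Lemma sum_levels_lt K t J : 0 < K -> 0 <= t ->
  \sum_(i < J) level K i ^+ 2 * ((level K i < t)%R)%:R <= 2 * t ^+ 2.
Proof.
move=> K0 t0; set S := fun J => \sum_(i < J) level K i ^+ 2 * ((level K i < t)%R)%:R.
(* The squared levels below [t] form a geometric series of ratio 1/4, hence 4/3. The case [S J = 0]
   covers the stage where all levels so far are at least [t] and the right-hand bound may be
   negative. *)
have : S J = 0 \/ S J <= 4 / 3 * (t ^+ 2 - level K J ^+ 2).
  elim: J => [|J IH]; first by left; rewrite /S big_ord0.
  have := levelS K J; have := level_gt0 J.+1 K0.
  rewrite /S big_ord_recr /= -/(S J); move: (level K J.+1) => u u0 uE.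
  rewrite uE; case: ltP => [ut|_].
    right; rewrite mulr1; case: IH => [->|]; nra.
  rewrite mulr0 addr0; case: IH => [->|]; first by left.
  by rewrite uE; right; nra.
rewrite -/(S J); have := sqr_ge0 (level K J); have := sqr_ge0 t.
by move=> t2 l2 [->|]; lra.
Qed.

Lemma sum_levels_sqr K J : \sum_(i < J) level K i ^+ 2 <= K ^+ 2.
Proof.
suff -> : \sum_(i < J) level K i ^+ 2 = (K ^+ 2 - 4 * level K J ^+ 2) / 3.
  by have := sqr_ge0 (level K J); have := sqr_ge0 K; lra.
elim: J => [|J IH]; first by rewrite big_ord0 /level expr1; field.
by rewrite big_ord_recr /= IH (levelS K J); field.
Qed.

End dyadic.

(** * The net of averages of signed basis functions *)

Section iid_mean_exchange.
Context {R : realType} {I : finType} (w : I -> R).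

Lemma bmeas_iid_mean d (U : measurableType d) T (H : seq I -> U -> R) :
  (forall l, bmeas (H l)) -> bmeas (fun x => iid_mean w T (H^~ x)).
Proof.
elim: T H => [//|T IH] H bH /=; first exact: bH.
apply: bmeas_sum => k; apply: bmeasM; first exact: bmeas_cst.
exact: (IH (fun l => H (k :: l))).
Qed.

Lemma mean_iid_mean d (U : measurableType d) (Q : probability U R) T
    (H : seq I -> U -> R) : (forall l, bmeas (H l)) ->
  mean Q (fun x => iid_mean w T (H^~ x)) = iid_mean w T (fun l => mean Q (H l)).
Proof.
elim: T H => [//|T IH] H bH /=.
rewrite mean_sum; last first.
  move=> k; apply: bmeasM; first exact: bmeas_cst.
  exact: (bmeas_iid_mean T (H := fun l => H (k :: l))).
apply: eq_bigr => k _; rewrite meanZ; last first.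
  exact: (bmeas_iid_mean T (H := fun l => H (k :: l))).
by rewrite (IH (fun l => H (k :: l))).
Qed.

Lemma emp_iid_mean m (y : 'I_m -> R) T (H : seq I -> R -> R) :
  emp (fun x => iid_mean w T (H^~ x)) y = iid_mean w T (fun l => emp (H l) y).
Proof.
rewrite /emp -iid_mean_sum mulrC -iid_meanZ.
by apply: eq_iid_mean => l _; rewrite mulrC.
Qed.

End iid_mean_exchange.

Section emp_linear.
Context {R : realType} (m : nat) (y : 'I_m -> R).
Implicit Types F G : R -> R.

Lemma empD F G : emp (fun x => F x + G x) y = emp F y + emp G y.
Proof. by rewrite /emp big_split mulrDl. Qed.

Lemma empZ c F : emp (fun x => c * F x) y = c * emp F y.
Proof. by rewrite /emp -mulr_sumr mulrA. Qed.

Lemma emp_sum (J : Type) (r : seq J) (F : J -> R -> R) :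
  emp (fun x => \sum_(i <- r) F i x) y = \sum_(i <- r) emp (F i) y.
Proof. by rewrite /emp exchange_big mulr_suml. Qed.

Lemma emp_le F G : (forall x, F x <= G x) -> emp F y <= emp G y.
Proof. by move=> FG; rewrite ler_wpM2r ?invr_ge0// ler_sum. Qed.

End emp_linear.

Section net.
Context {R : realType} (n : nat) (phi : 'I_n -> R -> R) (K : R).
Context (K_gt0 : 0 < K) (bphi : forall k, bmeas (phi k)).
Context (phiK : forall k x, `|phi k x| <= K).

Definition lincomb (v : 'I_n -> R) (x : R) := \sum_k v k * phi k x.

Definition atom (x : R) (i : 'I_n * bool) : R := (-1) ^+ i.2 * phi i.1 x.

Definition net_fun (l : seq ('I_n * bool)) (x : R) := sample_mean (atom x) l.

Lemma bmeas_lincomb v : bmeas (lincomb v).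
Proof. by apply: bmeas_sum => k; apply: bmeasM => //; exact: bmeas_cst. Qed.

Lemma bmeas_net_fun l : bmeas (net_fun l).
Proof.
rewrite /net_fun /sample_mean; apply: bmeasM; last exact: bmeas_cst.
by apply: bmeas_sum => i; apply: bmeasM => //; exact: bmeas_cst.
Qed.

Lemma atom_le x i : `|atom x i| <= K.
Proof. by rewrite normrM normrX normrN1 expr1n mul1r. Qed.

Lemma mean_lincomb_sqr (Q : probability R R) v :
  (forall j k, mean Q (fun x => phi j x * phi k x) = (j == k)%:R) ->
  mean Q (fun x => lincomb v x ^+ 2) = \sum_k v k ^+ 2.
Proof.
move=> ortho.
have bjk j k : bmeas (fun x => phi j x * phi k x) by exact: bmeasM.
have bc j k : bmeas (fun x => v j * v k * (phi j x * phi k x)).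
  by apply: bmeasM => //; exact: bmeas_cst.
transitivity (mean Q (fun x => \sum_j \sum_k v j * v k * (phi j x * phi k x))).
  congr mean; apply/funext => x; rewrite expr2 {1}/lincomb mulr_suml.
  apply: eq_bigr => j _; rewrite /lincomb mulr_sumr.
  by apply: eq_bigr => k _; rewrite mulrACA.
rewrite mean_sum; last by move=> j; exact: bmeas_sum.
apply: eq_bigr => j _; rewrite mean_sum// (bigD1 j)//= big1.
  by rewrite meanZ// ortho eqxx mulr1 addr0.
by move=> k kj; rewrite meanZ// ortho eq_sym (negbTE kj) mulr0.
Qed.

Section weights.
Context (v : 'I_n -> R) (v1 : \sum_k `|v k| = 1).

(** Lives on the atoms whose sign agrees with that of [v k]. For [||v||_1 = 1] it is a probability,
    and its mean atom is [lincomb v]. *)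
Definition sign_weight (i : 'I_n * bool) : R :=
  `|v i.1| * (i.2 == (v i.1 < 0))%:R.

Lemma sign_weight_ge0 i : 0 <= sign_weight i.
Proof. by rewrite mulr_ge0. Qed.

Lemma sum_sign_weight (F : 'I_n * bool -> R) :
  \sum_i sign_weight i * F i = \sum_k `|v k| * F (k, v k < 0).
Proof.
transitivity (\sum_k \sum_b sign_weight (k, b) * F (k, b)).
  by rewrite pair_bigA/=; apply: eq_bigr => -[].
apply: eq_bigr => k _; rewrite big_bool /sign_weight/=.
by case: (v k < 0); rewrite ?mulr1 ?mulr0 ?mul0r ?addr0 ?add0r.
Qed.

Lemma sign_weight1 : \sum_i sign_weight i = 1.
Proof.
rewrite -v1; under eq_bigr do rewrite -[sign_weight _]mulr1.
by rewrite (sum_sign_weight (fun=> 1)); under eq_bigr do rewrite mulr1.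
Qed.

Lemma sum_sign_weight_atom x : \sum_i sign_weight i * atom x i = lincomb v x.
Proof.
rewrite sum_sign_weight; apply: eq_bigr => k _.
by rewrite /atom/= mulrA [`|v k| * _]mulrC mulr_sign_norm.
Qed.

(** The second moment of a random atom at [x]. Pointwise it is only bounded by [K^2], but for
    orthonormal [phi] and [||v||_1 = 1] its mean is 1; for this reason the errors below are kept
    proportional to it. *)
Definition var_bound (x : R) := \sum_k `|v k| * phi k x ^+ 2.

Lemma sum_sign_weight_atom2 x :
  \sum_i sign_weight i * atom x i ^+ 2 = var_bound x.
Proof.
rewrite sum_sign_weight; apply: eq_bigr => k _.
by rewrite /atom/= exprMn sqrr_sign mul1r.
Qed.

Lemma bmeas_var_bound : bmeas var_bound.
Proof.
apply: bmeas_sum => k; apply: bmeasM; first exact: bmeas_cst.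
exact: bmeasX.
Qed.

Lemma lincomb_le x : `|lincomb v x| <= K.
Proof.
apply: le_trans (ler_norm_sum _ _ _) _.
apply: le_trans (_ : \sum_k `|v k| * K <= _); last by rewrite -mulr_suml v1 mul1r.
by apply: ler_sum => k _; rewrite normrM ler_wpM2l.
Qed.

Let E := iid_mean sign_weight.
Let w0 := sign_weight_ge0.
Let w1 := sign_weight1.

Lemma net_variance T x : (0 < T)%N ->
  E T (fun l => (net_fun l x - lincomb v x) ^+ 2) <= var_bound x / T%:R.
Proof.
move=> T0; have := sample_mean_variance w1 (atom x) T0.
by rewrite sum_sign_weight_atom sum_sign_weight_atom2.
Qed.

Lemma net_sqr T x : (0 < T)%N ->
  E T (fun l => net_fun l x ^+ 2) <= lincomb v x ^+ 2 + var_bound x / T%:R.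
Proof.
move=> T0; have := sample_mean_sqr w1 (atom x) T0.
by rewrite sum_sign_weight_atom sum_sign_weight_atom2.
Qed.

Lemma net_tail T u z x : (0 < T)%N -> 0 < u -> u <= K -> 2 <= z ->
  T%:R * u ^+ 2 = 64 * z * K ^+ 2 ->
  E T (fun l => ((u / 4 <= `|net_fun l x - lincomb v x|)%R)%:R)
  <= 2 * z * expR (- (z / 2)) * (var_bound x / K ^+ 2).
Proof.
move=> T0 u0 uK z2 Tu.
have := sample_mean_tail w0 w1 K_gt0 (@atom_le x) T0 u0 uK z2 Tu.
by rewrite sum_sign_weight_atom sum_sign_weight_atom2.
Qed.

Lemma var_bound_le x : var_bound x <= K ^+ 2.
Proof.
by rewrite -sum_sign_weight_atom2; exact: (mean_sqr_le w0 w1 K_gt0 (@atom_le x)).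
Qed.

(** Chebyshev's inequality: the variance is at most [u^2 / 8], so where [|f| > u] the average drops
    to [u / 2] or below with probability at most 1/2. *)
Lemma level_set_net T u x : (0 < T)%N -> 0 < u -> 8 * K ^+ 2 <= T%:R * u ^+ 2 ->
  ((u < `|lincomb v x|)%R)%:R <= 2 * E T (fun l => ((u / 2 < `|net_fun l x|)%R)%:R).
Proof.
move=> T0 u0 Tu; have u2 : 0 < u ^+ 2 by rewrite exprn_gt0.
have TR0 : 0 < (T%:R : R) by rewrite ltr0n.
case: ltP => [uf|_]; last first.
  by rewrite mulr_ge0// -(iid_mean_cst w1 T 0); apply: iid_mean_le.
have : 1 <= E T (fun l => ((u / 2 < `|net_fun l x|)%R)%:R +
    4 / u ^+ 2 * (net_fun l x - lincomb v x) ^+ 2).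
  rewrite -[leLHS](iid_mean_cst w1 T); apply: iid_mean_le => // l _.
  have h0 : 0 <= 4 / u ^+ 2 * (net_fun l x - lincomb v x) ^+ 2.
    by rewrite mulr_ge0 ?sqr_ge0// divr_ge0 ?ltW.
  case: ltP => [_|gu]; first by rewrite lerDl.
  rewrite add0r -(real_normK (num_real (_ - _))) mulrAC ler_pdivlMr// mul1r.
  have := ler_distD (net_fun l x) 0 (lincomb v x).
  rewrite !sub0r !normrN => tri.
  have : u / 2 <= `|net_fun l x - lincomb v x| by lra.
  by nra.
rewrite /E iid_meanD iid_meanZ -/E => h.
have : 4 / u ^+ 2 * E T (fun l => (net_fun l x - lincomb v x) ^+ 2) <= 2^-1.
  rewrite mulrAC ler_pdivrMr//; apply: le_trans (ler_wpM2l _ (net_variance x T0)) _ => //.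
  rewrite mulrA ler_pdivrMr//; have := var_bound_le x; nra.
by move: h; set E1 := E T _; set E2 := E T _; move=> h le2; apply: (@le_trans _ _ 1) => //; lra.
Qed.

(** Pointwise [min(f^2, B) <= 2 min(g^2, B) + 2 (g - f)^2]. The average is truncated too because the
    lower tail pays for the supremum of the function it is applied to. *)
Lemma low_level_net T B x : (0 < T)%N -> 0 <= B ->
  Num.min (lincomb v x ^+ 2) B <=
  2 * E T (fun l => Num.min (net_fun l x ^+ 2) B) + 2 * (var_bound x / T%:R).
Proof.
move=> T0 B0.
apply: (@le_trans _ _ (E T (fun l => 2 * Num.min (net_fun l x ^+ 2) B +
   2 * (net_fun l x - lincomb v x) ^+ 2))).
  rewrite -[leLHS](iid_mean_cst w1 T); apply: iid_mean_le => // l _.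
  set f := lincomb v x; set g := net_fun l x.
  case: (leP (g ^+ 2) B) => gB.
    by rewrite ge_min; apply/orP; left; have := sqr_ge0 (g + (g - f)); nra.
  rewrite ge_min; apply/orP; right; have := sqr_ge0 (g - f); lra.
rewrite /E iid_meanD !iid_meanZ -/E lerD2l ler_wpM2l//.
exact: net_variance.
Qed.

(** If [|g| > u / 2] then either [|f| > u / 4] or [g] is at least [u / 4] away from [f]. For this
    length [T], Chebyshev's inequality would bound the second case only by order [1 / z], far above
    the [1 / s] allowed when [z] is of order [log s]. *)
Lemma high_level_net T u z x : (0 < T)%N -> 0 < u -> u <= K -> 2 <= z ->
  T%:R * u ^+ 2 = 64 * z * K ^+ 2 ->
  E T (fun l => ((u / 2 < `|net_fun l x|)%R)%:R) <=
  ((u < 4 * `|lincomb v x|)%R)%:R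
  + 2 * z * expR (- (z / 2)) * (var_bound x / K ^+ 2).
Proof.
move=> T0 u0 uK z2 Tu.
apply: le_trans (_ : E T (fun l => ((u < 4 * `|lincomb v x|)%R)%:R +
  ((u / 4 <= `|net_fun l x - lincomb v x|)%R)%:R) <= _).
  apply: iid_mean_le => // l _; case: (ltP u) => [_|fu].
    by apply: le_trans (_ : 1 <= _); [case: (_ < _)|rewrite lerDl].
  rewrite add0r; case: (ltP (u / 2)) => // gu.
  case: (leP (u / 4)) => //; have := ler_distD (lincomb v x) 0 (net_fun l x).
  rewrite !sub0r !normrN distrC => tri h.
  by exfalso; lra.
rewrite /E iid_meanD iid_mean_cst// lerD2l -/E.
exact: net_tail.
Qed.

End weights.
End net.

(** * The lower bound (1) *)

Section restricted_lower_bound.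
Context {R : realType} (n : nat) (phi : 'I_n -> R -> R) (K : R).
Context (K_gt0 : 0 < K) (bphi : forall k, bmeas (phi k)).
Context (phiK : forall k x, `|phi k x| <= K).
Context (Q : probability R R).
Context (ortho : forall j k, mean Q (fun x => phi j x * phi k x) = (j == k)%:R).

Definition high_net i (l : seq ('I_n * bool)) (x : R) : R :=
  ((level K i / 2 < `|net_fun phi l x|)%R)%:R.

Definition low_net B (l : seq ('I_n * bool)) (x : R) : R :=
  Num.min (net_fun phi l x ^+ 2) B.

Lemma bmeas_high_net i l : bmeas (high_net i l).
Proof. by apply: bmeas_gt_norm; exact: bmeas_net_fun. Qed.

Lemma bmeas_low_net B l : bmeas (low_net B l).
Proof. by apply: bmeas_min; apply: bmeasX; exact: bmeas_net_fun. Qed.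

Lemma level_le i : level K i <= K.
Proof.
rewrite /level ler_pdivrMr ?exprn_gt0// -[leLHS]mulr1 ler_pM2l//.
by apply: exprn_ege1; rewrite ler1n.
Qed.

(** The deterministic core, for any sample [y] on which the nets obey the lower deviations with
    errors [p] and [p']. In [516 = 4 + 4 * 128] the first 4 comes from the truncated part; in
    [128 = 4 * 32] one factor 2 is paid for passing to the net, another for passing to the sample,
    and 32 for coming back to [f]. *)
Lemma net_lower_bound m (y : 'I_m -> R) (v : 'I_n -> R)
    (J : nat) (T : nat -> nat) (T' : nat) (z : R) (p : nat -> R) (p' : R) :
  (forall i, (0 < T i)%N) -> (0 < T')%N -> 2 <= z ->
  (forall i, (T i)%:R * level K i ^+ 2 = 64 * z * K ^+ 2) ->
  (forall (i : 'I_J) l, size l = T i ->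
     mean Q (high_net i l) <= 2 * emp (high_net i l) y + p i) ->
  (forall l, size l = T' ->
     mean Q (low_net (K ^+ 2 / 4 ^+ J) l)
     <= 2 * emp (low_net (K ^+ 2 / 4 ^+ J) l) y + p') ->
  (forall k, emp (fun x => phi k x ^+ 2) y <= 3) ->
  \sum_k `|v k| = 1 ->
  \sum_k v k ^+ 2 <= 516 * emp (fun x => lincomb phi v x ^+ 2) y
    + (14 / T'%:R + 2 * p' + 8 * (\sum_(i < J) level K i ^+ 2 * p i)
       + 96 * z * expR (- (z / 2))).
Proof.
move=> T0 T'0 z2 TE H1 H2 H3 v1; set a := emp _ y.
set B := K ^+ 2 / 4 ^+ J in H2.
have B0 : 0 <= B by rewrite divr_ge0 ?sqr_ge0// exprn_ge0.
have T'R : 0 < (T'%:R : R) by rewrite ltr0n.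
pose f := lincomb phi v; pose V := var_bound phi v.
pose E := iid_mean (sign_weight v).
have w0 := sign_weight_ge0 v; have w1 := sign_weight1 v1.
have bf : bmeas f by exact: bmeas_lincomb.
have bf2 : bmeas (fun x => f x ^+ 2) by exact: bmeasX.
have bV : bmeas V by exact: bmeas_var_bound.
have bZ c (F : R -> R) : bmeas F -> bmeas (fun x => c * F x).
  by move=> bF; apply: bmeasM => //; exact: bmeas_cst.
have bmin : bmeas (fun x => Num.min (f x ^+ 2) B) by exact: bmeas_min.
have bind i : bmeas (fun x => ((level K i < `|f x|)%R)%:R : R) by exact: bmeas_gt_norm.
have bEh i : bmeas (fun x => E (T i) (fun l => high_net i l x)).
  by apply: (bmeas_iid_mean _ _ (H := high_net i)) => l; exact: bmeas_high_net.
have bEl : bmeas (fun x => E T' (fun l => low_net B l x)).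
  by apply: (bmeas_iid_mean _ _ (H := low_net B)) => l; exact: bmeas_low_net.
have meanV : mean Q V = 1.
  rewrite mean_sum; last by move=> k; apply: bZ; exact: bmeasX.
  rewrite -v1; apply: eq_bigr => k _; rewrite meanZ; last exact: bmeasX.
  by rewrite ortho eqxx mulr1.
have empV : emp V y <= 3.
  rewrite emp_sum [leRHS](_ : _ = \sum_k `|v k| * 3); last first.
    by rewrite -mulr_suml v1 mul1r.
  by apply: ler_sum => k _; rewrite empZ ler_wpM2l.
have split_mean : \sum_k v k ^+ 2 <= mean Q (fun x => Num.min (f x ^+ 2) B)
    + 4 * \sum_(i < J) level K i ^+ 2 * mean Q (fun x => ((level K i < `|f x|)%R)%:R).
  rewrite -(mean_lincomb_sqr bphi v ortho).
  under [X in _ + _ * X]eq_bigr do rewrite -meanZ//.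
  rewrite -mean_sum; last by move=> i; exact: bZ.
  have bs : bmeas (fun x => \sum_(i < J) level K i ^+ 2 * ((level K i < `|f x|)%R)%:R).
    by apply: bmeas_sum => i; exact: bZ.
  rewrite -meanZ// -meanD//; last exact: bZ.
  apply: mean_le => //; first by apply: bmeasD => //; exact: bZ.
  move=> x; apply: layer_cake; exact: lincomb_le.
have low : mean Q (fun x => Num.min (f x ^+ 2) B) <= 4 * a + 2 * p' + 14 / T'%:R.
  have : mean Q (fun x => Num.min (f x ^+ 2) B) <=
      2 * mean Q (fun x => E T' (fun l => low_net B l x)) + 2 / T'%:R.
    rewrite [X in _ <= _ + X](_ : _ = mean Q (fun x => 2 / T'%:R * V x)); last first.
      by rewrite meanZ// meanV mulr1.
    rewrite -meanZ// -meanD//; [|exact: bZ|exact: bZ].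
    apply: mean_le => //; first by apply: bmeasD; exact: bZ.
    move=> x; rewrite -mulrA (mulrC _^-1); exact: low_level_net.
  have : mean Q (fun x => E T' (fun l => low_net B l x)) <=
      2 * emp (fun x => E T' (fun l => low_net B l x)) y + p'.
    rewrite (mean_iid_mean _ _ _ (H := low_net B)); last by move=> l; exact: bmeas_low_net.
    rewrite (emp_iid_mean (sign_weight v) y T' (low_net B)).
    rewrite -(iid_mean_cst w1 T' p') -iid_meanZ -iid_meanD.
    by apply: iid_mean_le.
  have : emp (fun x => E T' (fun l => low_net B l x)) y <= a + 3 / T'%:R.
    apply: (@le_trans _ _ (emp (fun x => f x ^+ 2 + (T'%:R)^-1 * V x) y)).
      apply: emp_le => x; rewrite (mulrC _^-1).
      apply: le_trans (net_sqr phi v1 x T'0).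
      by apply: iid_mean_le => // l _; rewrite /low_net ge_min lexx.
    rewrite empD empZ lerD2l (mulrC 3) ler_wpM2l// invr_ge0//.
  lra.
have high : \sum_(i < J) level K i ^+ 2 * mean Q (fun x => ((level K i < `|f x|)%R)%:R)
    <= 128 * a + 24 * z * expR (- (z / 2)) + 2 * \sum_(i < J) level K i ^+ 2 * p i.
  have : \sum_(i < J) level K i ^+ 2 * mean Q (fun x => ((level K i < `|f x|)%R)%:R)
      <= \sum_(i < J) level K i ^+ 2 *
         (4 * emp (fun x => E (T i) (fun l => high_net i l x)) y + 2 * p i).
    apply: ler_sum => i _; rewrite ler_wpM2l ?sqr_ge0//.
    have : mean Q (fun x => ((level K i < `|f x|)%R)%:R) <=
        2 * mean Q (fun x => E (T i) (fun l => high_net i l x)).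
      rewrite -meanZ//; apply: mean_le => //; first exact: bZ.
      move=> x; apply: (level_set_net K_gt0 phiK v1) => //; first exact: level_gt0.
      by rewrite TE ler_wpM2r ?sqr_ge0//; lra.
    have : mean Q (fun x => E (T i) (fun l => high_net i l x)) <=
        2 * emp (fun x => E (T i) (fun l => high_net i l x)) y + p i.
      rewrite (mean_iid_mean _ _ _ (H := high_net i)); last by move=> l; exact: bmeas_high_net.
      rewrite (emp_iid_mean (sign_weight v) y (T i) (high_net i)).
      rewrite -(iid_mean_cst w1 (T i) (p i)) -iid_meanZ -iid_meanD.
      by apply: iid_mean_le => // l; exact: H1.
    lra.
  have : emp (fun x => \sum_(i < J) level K i ^+ 2 * E (T i) (fun l => high_net i l x)) y
      <= 32 * a + 6 * z * expR (- (z / 2)).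
    pose e := 2 * z * expR (- (z / 2)).
    have e0 : 0 <= e by rewrite mulr_ge0 ?expR_ge0//; lra.
    apply: (@le_trans _ _ (emp (fun x => 32 * f x ^+ 2 + e * V x) y)).
      apply: emp_le => x.
      have V0 : 0 <= V x by apply: sumr_ge0 => k _; rewrite mulr_ge0 ?sqr_ge0.
      apply: (@le_trans _ _ (\sum_(i < J) (level K i ^+ 2 * ((level K i < 4 * `|f x|)%R)%:R
          + level K i ^+ 2 * (e * (V x / K ^+ 2))))).
        apply: ler_sum => i _; rewrite -mulrDr ler_wpM2l ?sqr_ge0//.
        by apply: high_level_net => //; [exact: level_gt0|exact: level_le].
      rewrite big_split /= lerD//.
        (* The levels below [4 |f x|] contribute at most [2 * 16 f(x)^2], hence the 32. *)
        have /le_trans := sum_levels_lt J K_gt0 (mulr_ge0 (ler0n R 4) (normr_ge0 (f x))).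
        apply; rewrite exprMn real_normK ?num_real//; lra.
      rewrite -mulr_suml; apply: le_trans (ler_wpM2r _ (sum_levels_sqr K J)) _.
        by rewrite mulr_ge0// divr_ge0// sqr_ge0.
      by rewrite le_eqVlt; apply/orP; left; apply/eqP; field; rewrite gt_eqF.
    rewrite empD !empZ lerD2l; apply: le_trans (ler_wpM2l e0 empV) _.
    by rewrite /e le_eqVlt; apply/orP; left; apply/eqP; ring.
  rewrite emp_sum; under eq_bigr do rewrite empZ.
  rewrite [X in _ -> _ <= X -> _](_ : _ = 4 * \sum_(i < J) level K i ^+ 2 *
    emp (fun x => E (T i) (fun l => high_net i l x)) y + 2 * \sum_(i < J) level K i ^+ 2 * p i).
    lra.
  rewrite !mulr_sumr -big_split; apply: eq_bigr => i _ /=; ring.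
lra.
Qed.

End restricted_lower_bound.

(** * Union bounds over the nets and the error budget *)

Lemma union_bound d (T : measurableType d) (R : realType) (P : probability T R)
    (I : finType) (A : I -> set T) (c : R) :
  (forall i, measurable (A i)) -> (forall i, (P (A i) <= c%:E)%E) ->
  exists U, [/\ measurable U, (P U <= (#|I|%:R * c)%:E)%E & forall i, A i `<=` U].
Proof.
move=> mA Ac.
suff [U [mU PU AU]] : exists U, [/\ measurable U,
    (P U <= ((size (enum I))%:R * c)%:E)%E & forall i, i \in enum I -> A i `<=` U].
  by exists U; split=> // [|i]; [rewrite cardE|apply: AU; rewrite mem_enum].
elim: (enum I) => [|i s [U [mU PU AU]]].
  by exists set0; split=> //; rewrite mul0r measure0.
exists (A i `|` U); split; first exact: measurableU.
  apply: le_trans (measureU2 P (mA i) mU) _.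
  by rewrite /= -natr1 mulrDl mul1r addrC EFinD leeD.
move=> j; rewrite inE => /predU1P[->|js]; first exact: subsetUl.
by apply: subset_trans (AU j js) _; exact: subsetUr.
Qed.

Section parameters.
Context {R : realType}.

Lemma ln2_ge : (2^-1 : R) <= ln 2.
Proof.
rewrite -ler_expR lnK ?posrE//.
apply: le_trans (expR_le_lin _ _) _ => //; lra.
Qed.

Lemma expR1_ge2 : (2 : R) <= expR 1.
Proof. by have := expR_ge1Dx (1 : R); lra. Qed.

Lemma up_log_ln (s : nat) : (1 < s)%N -> let J := up_log 2 s in
  [/\ (0 < J)%N, (s <= 2 ^ J)%N, J%:R / 4 <= ln (s%:R : R) & ln (s%:R : R) <= J%:R].
Proof.
move=> s1 /=; have /andP[] := up_log_bounds (isT : 1 < 2)%N s1.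
have : (0 < up_log 2 s)%N by rewrite up_log_gt0.
move: (up_log 2 s) => J J0 sl su.
have s0 : 0 < (s%:R : R) by rewrite ltr0n ltnW.
split=> //.
  (* From [2 ^ J.-1 < s] and [2 <= s]; with the crude [ln 2 >= 1/2] this yields [J / 4 <= ln s]. *)
  have : (2 ^ J <= s ^ 2)%N.
    rewrite -(prednK J0) expnS -mulnn; apply: leq_mul => //; exact: ltnW.
  rewrite -(ler_nat R) !natrX -ler_ln ?posrE ?exprn_gt0// !lnXn//.
  rewrite -[ln _ *+ J]mulr_natl -[ln _ *+ 2]mulr_natl => h; have := ler_wpM2l (ler0n R J) ln2_ge.
  by move: h; set a := ln _; set b := ln _; set c := J%:R * a; lra.
rewrite -ler_expR lnK ?posrE//.
apply: (@le_trans _ _ (2 ^+ J)); first by rewrite -natrX ler_nat.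
rewrite -[J%:R]mulr1 expRM_natl lerXn2r ?nnegrE ?expR_ge0//.
exact: expR1_ge2.
Qed.

(** The exponent is split into two halves [x = 16 J]. One absorbs the prefactor through
    [x exp(-x) <= 1]; the other beats [s], since [exp x >= (2^J)^16 >= s 2^15]. *)
Lemma exp_budget (J s : nat) : (0 < J)%N -> (0 < s)%N -> (s <= 2 ^ J)%N ->
  96 * (64 * J%:R) * expR (- (64 * J%:R / 2)) <= (64 * s%:R)^-1 :> R.
Proof.
move=> J0 s0 sJ; have sR : 0 < (s%:R : R) by rewrite ltr0n.
set x : R := 16 * J%:R.
have xe : x * expR (- x) <= 1.
  have := expR_ge1Dx x; have := expR_gt0 (- x).
  have : expR x * expR (- x) = 1 by rewrite -expRD subrr expR0.
  nra.
rewrite (_ : 64 * J%:R / 2 = x + x); last by rewrite /x; field.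
rewrite opprD expRD.
apply: (@le_trans _ _ (384 * expR (- x))).
  rewrite (_ : _ * _ = 384 * (x * expR (- x)) * expR (- x)); last by rewrite /x; ring.
  by rewrite ler_wpM2r ?expR_ge0//; lra.
suff h : 384 * (64 * s%:R) <= expR x.
  have s64 : 0 < 64 * s%:R :> R by rewrite mulr_gt0.
  rewrite -(ler_pM2r s64) mulVf; last by rewrite gt_eqF.
  have := ler_wpM2r (expR_ge0 (- x)) h.
  by rewrite -[X in _ <= X -> _]expRD subrr expR0; lra.
apply: (@le_trans _ _ (2 ^+ (16 * J))); last first.
  rewrite /x -natrM -[X in expR X]mulr1 expRM_natl lerXn2r ?nnegrE ?expR_ge0//.
  exact: expR1_ge2.
have q2 : (2 : R) <= 2 ^+ J by rewrite -[leLHS]expr1 ler_eXn2l ?ltr1n.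
have sq : (s%:R : R) <= 2 ^+ J by rewrite -natrX ler_nat.
rewrite mulnC exprM (exprS _ 15); move: (2 ^+ J) q2 sq => q q2 sq.
have q15 : 2 ^+ 15 <= q ^+ 15 by rewrite lerXn2r ?nnegrE//; lra.
apply: (@le_trans _ _ (q * 2 ^+ 15)); last by rewrite ler_wpM2l//; lra.
lra.
Qed.

End parameters.

Section uniform_deviation.
Context d {T : measurableType d} {R : realType} (P : probability T R).
Context (m : nat) (X : 'I_m -> {RV P >-> R}) (indep : mutually_independent X).
Context (Q : probability R R).
Context (law : forall j B, measurable B -> P (X j @^-1` B) = Q B).
Context (m0 : (0 < m)%N) (n : nat) (n0 : (0 < n)%N) (tau : R).

(** Twice the logarithm of the number [(2 n)^t] of averages of length [t], plus [tau]: one copy pays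
    for the union within a net, the other for sharing the failure probability between the nets. *)
Definition net_tau (t : nat) : R := 2 * t%:R * ln (2 * n%:R) + tau.

Lemma count_net_tau (c t g : nat) : (c <= (n * 2) ^ t)%N -> (0 < g)%N -> (g <= t)%N ->
  c%:R * expR (- net_tau t) <= expR (- tau) / g%:R.
Proof.
move=> ct g0 gt; have n2 : 0 < (2 * n%:R : R) by rewrite mulr_gt0 ?ltr0n.
have gR : 0 < (g%:R : R) by rewrite ltr0n.
have q0 : 0 < (2 * n%:R : R) ^+ t by rewrite exprn_gt0.
rewrite /net_tau opprD expRD (_ : 2 * t%:R * ln (2 * n%:R) =
  t%:R * ln (2 * n%:R) + t%:R * ln (2 * n%:R)); last by ring.
rewrite opprD expRD (expRN (t%:R * _)) expRM_natl lnK ?posrE//.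
have cR : c%:R <= (2 * n%:R : R) ^+ t.
  by rewrite mulrC -natrM -natrX ler_nat.
have tg : g%:R <= (2 * n%:R : R) ^+ t.
  rewrite mulrC -natrM -natrX ler_nat (leq_trans gt)//.
  apply: ltnW; apply: (leq_trans (ltn_expl t (isT : 1 < 2)%N)).
  by rewrite leq_exp2r; [lia|lia].
move: ((2 * n%:R : R) ^+ t) q0 cR tg => q q0 cR tg.
rewrite ler_pdivlMr// mulrC !mulrA.
rewrite -[leRHS]mul1r ler_wpM2r ?expR_ge0//.
rewrite ler_pdivrMr// mul1r ler_pdivrMr//.
by rewrite ler_pM.
Qed.

Lemma net_deviation (I : finType) (F : I -> R -> R) (B : R) (t g : nat) :
  (#|I| <= (n * 2) ^ t)%N -> (0 < g)%N -> (g <= t)%N -> 0 < B ->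
  (forall l, bmeas (F l)) -> (forall l x, 0 <= F l x) -> (forall l x, F l x <= B) ->
  exists U, [/\ measurable U, (P U <= (expR (- tau) / g%:R)%:E)%E &
    forall w, ~ U w -> forall l,
      mean Q (F l) <= 2 * emp (F l) (X^~ w) + 2 * B * net_tau t / m%:R].
Proof.
move=> It g0 gt B0 bF F0 FB.
have [||U [mU PU AU]] := union_bound (P := P)
  (A := fun l => [set w | 2 * emp (F l) (X^~ w) + 2 * B * net_tau t / m%:R < mean Q (F l)])
  (c := expR (- net_tau t)).
- move=> l; apply: measurable_lt_bmeas; last exact: bmeas_cst.
  apply: bmeasD; last exact: bmeas_cst.
  by apply: bmeasM; [exact: bmeas_cst|exact: bmeas_emp].
- by move=> l; exact: lower_tail.
exists U; split=> //.
  by apply: le_trans PU _; rewrite lee_fin; exact: count_net_tau.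
by move=> w Uw l; rewrite leNgt; apply/negP => h; apply: Uw; apply: (AU l).
Qed.

Lemma upper_deviation (F : 'I_n -> R -> R) (B : R) (t g : nat) :
  (0 < g)%N -> (g <= t)%N -> 0 < B ->
  (forall l, bmeas (F l)) -> (forall l x, 0 <= F l x) -> (forall l x, F l x <= B) ->
  exists U, [/\ measurable U, (P U <= (expR (- tau) / g%:R)%:E)%E &
    forall w, ~ U w -> forall l,
      emp (F l) (X^~ w) <= 2 * mean Q (F l) + 2 * B * net_tau t / m%:R].
Proof.
move=> g0 gt B0 bF F0 FB.
have [||U [mU PU AU]] := union_bound (P := P)
  (A := fun l => [set w | 2 * mean Q (F l) + 2 * B * net_tau t / m%:R < emp (F l) (X^~ w)])
  (c := expR (- net_tau t)).
- move=> l; apply: measurable_lt_bmeas; first exact: bmeas_cst.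
  exact: bmeas_emp.
- by move=> l; exact: upper_tail.
exists U; split=> //.
  apply: le_trans PU _; rewrite lee_fin; apply: count_net_tau => //.
  rewrite card_ord -[leqLHS]expn1; apply: leq_trans (_ : (n * 2) ^ 1 <= _)%N.
    by rewrite !expn1; lia.
  by rewrite leq_pexp2l; lia.
by move=> w Uw l; rewrite leNgt; apply/negP => h; apply: Uw; apply: (AU l).
Qed.

Context (phi : 'I_n -> R -> R) (K : R).
Context (K_gt0 : 0 < K) (bphi : forall k, bmeas (phi k)).
Context (phiK : forall k x, `|phi k x| <= K).

(** There are [J + 2] families: the levels, the truncated net and the columns [phi_k^2]. Each may
    fail with probability [exp(- tau) / (J + 2)], which a length of at least [J + 2] makes
    affordable. *)
Lemma all_deviations (J : nat) (t : nat -> nat) (t' : nat) (B : R) : 0 < B ->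
  (forall i, J.+2 <= t i)%N -> (J.+2 <= t')%N ->
  exists U, [/\ measurable U, (P U <= (expR (- tau))%:E)%E &
    forall w, ~ U w ->
    [/\ forall (i : 'I_J) l, size l = t i -> mean Q (high_net phi K i l)
          <= 2 * emp (high_net phi K i l) (X^~ w) + 2 * 1 * net_tau (t i) / m%:R,
        forall l, size l = t' -> mean Q (low_net phi B l)
          <= 2 * emp (low_net phi B l) (X^~ w) + 2 * B * net_tau t' / m%:R &
        forall k, emp (fun x => phi k x ^+ 2) (X^~ w)
          <= 2 * mean Q (fun x => phi k x ^+ 2) + 2 * K ^+ 2 * net_tau J.+2 / m%:R]].
Proof.
move=> B0 tJ t'J.
have card_net s : (#|{: s.-tuple ('I_n * bool)}| <= (n * 2) ^ s)%N.
  by rewrite card_tuple card_prod card_ord card_bool.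
have hi (i : 'I_J) : exists U, [/\ measurable U, (P U <= (expR (- tau) / J.+2%:R)%:E)%E &
    forall w, ~ U w -> forall l : (t i).-tuple ('I_n * bool), mean Q (high_net phi K i l)
          <= 2 * emp (high_net phi K i l) (X^~ w) + 2 * 1 * net_tau (t i) / m%:R].
  apply: (@net_deviation _ (fun l : (t i).-tuple _ => high_net phi K i l)) => //.
  - by move=> l; exact: bmeas_high_net.
  - by move=> l x; rewrite /high_net; case: (_ < _).
have [U HU] := choice hi.
have [||Uh [mUh PUh AUh]] := union_bound (P := P) (A := U) (c := expR (- tau) / J.+2%:R).
- by move=> i; have [] := HU i.
- by move=> i; have [] := HU i.
have [||Ul [mUl PUl AUl]] := @net_deviation _ (fun l : t'.-tuple _ => low_net phi B l) B t' J.+2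
  (card_net t') isT t'J B0 (fun l => bmeas_low_net bphi B l).
- by move=> l x; rewrite le_min sqr_ge0 ltW.
- by move=> l x; rewrite ge_min lexx orbT.
have [||||Uc [mUc PUc AUc]] := @upper_deviation (fun k x => phi k x ^+ 2) (K ^+ 2) J.+2 J.+2 isT (leqnn _).
- by rewrite exprn_gt0.
- by move=> k; exact: bmeasX.
- by move=> k x; rewrite sqr_ge0.
- by move=> k x; rewrite -real_normK ?num_real// lerXn2r ?nnegrE// ltW.
exists (Uh `|` (Ul `|` Uc)); split.
- by apply: measurableU => //; exact: measurableU.
- apply: le_trans (measureU2 P mUh (measurableU _ _ mUl mUc)) _.
  apply: le_trans (leeD PUh (le_trans (measureU2 P mUl mUc) (leeD PUl PUc))) _.
  rewrite card_ord -!EFinD lee_fin; set e := expR _.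
  rewrite (_ : _ + _ = (J%:R + 2) * (e / J.+2%:R)); last by ring.
  by rewrite -natrD addn2 mulrCA mulfV// mulr1.
move=> w Uw; split.
- move=> i l sl; have [_ _] := HU i.
  have /[swap]/[apply] : ~ U i w by move=> h; apply: Uw; left; exact: (AUh i).
  by move=> /(_ (Tuple (introT eqP sl))).
- move=> l sl; have h : ~ Ul w by move=> h; apply: Uw; right; left.
  by have := AUl w h (Tuple (introT eqP sl)).
- by move=> k; apply: AUc => h; apply: Uw; right; right.
Qed.

End uniform_deviation.

(** The solution [T] of [T u^2 = 64 z K^2] for [u = level K i] and [z = 64 J]; an integer since the
    levels are dyadic. *)
Definition high_size (J i : nat) : nat := (2 ^ 12 * J * 4 ^ i.+1)%N.

(** Since [2^10 >= 14 * 64], the variance term [14 / T'] falls below [1 / (64 s)]. *)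
Definition low_size (J s : nat) : nat := (2 ^ 10 * s * J)%N.

Lemma high_sizeE (R : realType) J i :
  (high_size J i)%:R = 2 ^+ 12 * J%:R * 4 ^+ i.+1 :> R.
Proof. by rewrite -!natrX -!natrM. Qed.

Lemma low_sizeE (R : realType) J s :
  (low_size J s)%:R = 2 ^+ 10 * s%:R * J%:R :> R.
Proof. by rewrite -!natrX -!natrM. Qed.

Section error_budget.
Context {R : realType} (n m J s : nat) (K tau : R).
Context (n2 : (2 <= n)%N) (m0 : (0 < m)%N) (J0 : (0 < J)%N) (s0 : (0 < s)%N).
Context (K_gt0 : 0 < K) (sJ : (s <= 2 ^ J)%N).
Context (tau_le : tau <= J%:R ^+ 3 * ln n%:R).

Let lam : R := ln n%:R.
(** The unit for all deviation errors; the lower bound on [m] says that it is at most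
    [1 / (2^26 s)]. *)
Let W : R := K ^+ 2 * J%:R ^+ 3 * lam / m%:R.

Context (budget : 2 ^+ 26 * (K ^+ 2 * s%:R * J%:R ^+ 3 * lam) <= m%:R).

Let mR : 0 < (m%:R : R). Proof. by rewrite ltr0n. Qed.
Let sR : 1 <= (s%:R : R). Proof. by rewrite ler1n. Qed.
Let JR : 1 <= (J%:R : R). Proof. by rewrite ler1n. Qed.
Let lam_gt0 : 0 < lam. Proof. by rewrite ln_gt0// ltr1n. Qed.

Let W_ge0 : 0 <= W.
Proof. by rewrite !mulr_ge0 ?invr_ge0 ?sqr_ge0 ?exprn_ge0// ltW. Qed.

Let W_le : 2 ^+ 26 * s%:R * W <= 1.
Proof.
rewrite (_ : _ * W = 2 ^+ 26 * (K ^+ 2 * s%:R * J%:R ^+ 3 * lam) / m%:R).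
  by rewrite ler_pdivrMr// mul1r.
rewrite /W; set q := 2 ^+ 26; field.
by rewrite gt_eqF.
Qed.

Let J3 : J%:R <= (J%:R ^+ 3 : R).
Proof. by rewrite -[leLHS]expr1 ler_weXn2l. Qed.

Let net_tau_le t : net_tau n tau t <= (4 * t%:R + J%:R ^+ 3) * lam.
Proof.
have ln2n : ln (2 * n%:R) <= 2 * lam.
  have n0 : 0 < (n%:R : R) by rewrite ltr0n ltnW.
  rewrite lnM ?posrE// -/lam.
  have : ln 2 <= lam by rewrite ler_ln ?posrE// ler_nat.
  lra.
have := ler_wpM2l (ler0n R t) ln2n; move: tau_le; rewrite /net_tau -/lam.
move: (ln _) (J%:R ^+ 3) (t%:R) lam => a b c e; lra.
Qed.

Let net_tau_div t c : 4 * t%:R + J%:R ^+ 3 <= c * J%:R ^+ 3 ->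
  K ^+ 2 * net_tau n tau t / m%:R <= c * W.
Proof.
move=> tc; rewrite (_ : c * W = K ^+ 2 * (c * J%:R ^+ 3 * lam) / m%:R); last first.
  by rewrite /W; ring.
rewrite ler_wpM2r ?invr_ge0 ?(ltW mR)// ler_wpM2l ?sqr_ge0//.
by apply: le_trans (net_tau_le t) _; rewrite ler_wpM2r ?(ltW lam_gt0).
Qed.

Lemma column_budget : 2 * K ^+ 2 * net_tau n tau J.+2 / m%:R <= 1.
Proof.
have h : 4 * J.+2%:R + J%:R ^+ 3 <= 13 * J%:R ^+ 3 :> R.
  rewrite -addn2 natrD; move: J3 JR; lra.
have := net_tau_div h; have := W_le; have := W_ge0.
have : W <= s%:R * W by rewrite ler_peMl.
lra.
Qed.

(** Averages of length about [s J] would cost a deviation of order [s W]; the truncation factor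
    [4^-J <= 1 / s] cancels this [s]. *)
Lemma low_budget :
  14 / (low_size J s)%:R
    + 2 * (2 * (K ^+ 2 / 4 ^+ J) * net_tau n tau (low_size J s) / m%:R)
  <= (64 * s%:R)^-1 + 2 ^+ 15 * W.
Proof.
set t := low_size J s; apply: lerD.
  have sR0 : 0 < (s%:R : R) by rewrite ltr0n.
  have tR : 2 ^+ 10 * s%:R <= (t%:R : R).
    by rewrite /t low_sizeE ler_peMr// mulr_ge0// exprn_ge0.
  have t0 : 0 < (t%:R : R) by apply: lt_le_trans tR; rewrite mulr_gt0// exprn_gt0.
  have s64 : 0 < (64 * s%:R : R) by rewrite mulr_gt0.
  rewrite ler_pdivrMr// mulrC ler_pdivlMr//.
  apply: le_trans tR; lra.
have qs : s%:R <= 4 ^+ J :> R.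
  apply: (@le_trans _ _ (2 ^+ J)); first by rewrite -natrX ler_nat.
  by rewrite lerXn2r ?nnegrE ?ler_nat.
have q0 : 0 < (4 ^+ J : R) by rewrite exprn_gt0.
have tau_t : K ^+ 2 * net_tau n tau t / m%:R <= (2 ^+ 13 * s%:R) * W.
  apply: net_tau_div; rewrite /t low_sizeE.
  have J30 : 0 <= (J%:R ^+ 3 : R) by rewrite exprn_ge0.
  have sj : s%:R * J%:R <= s%:R * J%:R ^+ 3 :> R by rewrite ler_wpM2l.
  have sj3 : J%:R ^+ 3 <= s%:R * J%:R ^+ 3 :> R by rewrite ler_peMl.
  lra.
rewrite (_ : 2 * _ = 4 * (K ^+ 2 * net_tau n tau t / m%:R) / 4 ^+ J); last first.
  by field; rewrite !gt_eqF.
rewrite ler_pdivrMr//; apply: le_trans (ler_wpM2l _ tau_t) _ => //.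
have := ler_wpM2r W_ge0 qs; lra.
Qed.

(** The counting part of [net_tau] weighs the same at every level and gives [J * J <= J^3]. The part
    from [tau] is summed against the [u_i^2], whose sum is at most [K^2], so the number of levels
    does not multiply it. *)
Lemma high_budget :
  8 * (\sum_(i < J) level K i ^+ 2 * (2 * 1 * net_tau n tau (high_size J i) / m%:R))
  <= 2 ^+ 19 * W.
Proof.
pose t := high_size J.
have tE i : (t i)%:R * level K i ^+ 2 = 2 ^+ 12 * J%:R * K ^+ 2.
  rewrite /t high_sizeE level_sqr; field.
  by rewrite expf_neq0// pnatr_eq0.
pose c : R := 2 * lam / m%:R.
have c0 : 0 <= c by rewrite divr_ge0 ?mulr_ge0// ltW.
have step (i : 'I_J) : level K i ^+ 2 * (2 * 1 * net_tau n tau (high_size J i) / m%:R)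
    <= c * (2 ^+ 14 * J%:R * K ^+ 2 + J%:R ^+ 3 * level K i ^+ 2).
  rewrite (_ : c * _ = level K i ^+ 2 * (2 * ((4 * (t i)%:R + J%:R ^+ 3) * lam) / m%:R)).
    rewrite ler_wpM2l ?sqr_ge0// ler_wpM2r ?invr_ge0 ?(ltW mR)// mulr1 ler_wpM2l//.
  rewrite /c (_ : 2 ^+ 14 * J%:R * K ^+ 2 = 4 * ((t i)%:R * level K i ^+ 2)).
    by ring.
  by rewrite tE; ring.
apply: (@le_trans _ _ (8 * (c * (2 ^+ 14 * J%:R * K ^+ 2 * J%:R + J%:R ^+ 3 * K ^+ 2)))).
  rewrite ler_wpM2l//; apply: (le_trans (ler_sum _ (fun i _ => step i))).
  rewrite -mulr_sumr ler_wpM2l// big_split /= sumr_const card_ord -[_ *+ J]mulr_natr lerD2l.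
  by rewrite -mulr_sumr ler_wpM2l ?exprn_ge0// sum_levels_sqr.
have JJ : J%:R * J%:R <= J%:R ^+ 3 :> R.
  by rewrite exprSr -expr2 ler_peMr ?sqr_ge0.
apply: (@le_trans _ _ (8 * (c * (2 ^+ 15 * (J%:R ^+ 3 * K ^+ 2))))).
  rewrite ler_wpM2l// ler_wpM2l//.
  have := ler_wpM2r (sqr_ge0 K) JJ.
  have : 0 <= J%:R ^+ 3 * K ^+ 2 by rewrite mulr_ge0 ?sqr_ge0 ?exprn_ge0.
  lra.
rewrite /c /W le_eqVlt; apply/orP; left; apply/eqP; field.
by rewrite gt_eqF.
Qed.

Lemma total_budget :
  14 / (low_size J s)%:R
    + 2 * (2 * (K ^+ 2 / 4 ^+ J) * net_tau n tau (low_size J s) / m%:R)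
  + 8 * (\sum_(i < J) level K i ^+ 2 * (2 * 1 * net_tau n tau (high_size J i) / m%:R))
  + 96 * (64 * J%:R) * expR (- (64 * J%:R / 2)) <= (16 * s%:R)^-1.
Proof.
have h1 := @exp_budget R J s J0 s0 sJ; have h2 := high_budget; have h3 := low_budget.
apply: le_trans (lerD (lerD h3 h2) h1) _.
have sR0 : 0 < (s%:R : R) by rewrite ltr0n.
have : W <= (2 ^+ 26 * s%:R)^-1.
  rewrite -[leRHS]mul1r ler_pdivlMr; last by rewrite mulr_gt0// exprn_gt0.
  by rewrite mulrC.
rewrite !invfM; have : 0 < (s%:R : R)^-1 by rewrite invr_gt0.
move: (s%:R)^-1 => r; lra.
Qed.

End error_budget.

(** * Assembling (1) outside a small event *)

Lemma restricted_lower_bound (R : realType) d (T : measurableType d)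
    (P : probability T R) (m : nat) (X : 'I_m -> {RV P >-> R})
    (Q : probability R R) (n s J : nat) (phi : 'I_n -> R -> R) (K tau : R) :
  mutually_independent X ->
  (forall j B, measurable B -> P (X j @^-1` B) = Q B) ->
  (0 < m)%N -> (2 <= n)%N -> (0 < s)%N -> (0 < J)%N -> (s <= 2 ^ J)%N -> 0 < K ->
  (forall k, bmeas (phi k)) -> (forall k x, `|phi k x| <= K) ->
  (forall j k, mean Q (fun x => phi j x * phi k x) = (j == k)%:R) ->
  tau <= J%:R ^+ 3 * ln n%:R ->
  2 ^+ 26 * (K ^+ 2 * s%:R * J%:R ^+ 3 * ln n%:R) <= m%:R ->
  exists U, [/\ measurable U, (P U <= (expR (- tau))%:E)%E &
    forall w, ~ U w -> forall v,
      \sum_k v k ^+ 2 <= 516 * emp (fun x => lincomb phi v x ^+ 2) (X^~ w)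
        + (\sum_k `|v k|) ^+ 2 / (16 * s%:R)].
Proof.
move=> indep law m0 n2 s0 J0 sJ K0 bphi phiK ortho tau_le budget.
have n0 : (0 < n)%N by exact: ltnW.
have sR0 : 0 < (s%:R : R) by rewrite ltr0n.
have Jab a b : (2 < a)%N -> (0 < b)%N -> (J.+2 <= a * b * J)%N.
  move=> a3 b0; apply: (@leq_trans (3 * J)); first by lia.
  by rewrite leq_mul2r; apply/orP; right; nia.
have tJ i : (J.+2 <= high_size J i)%N.
  rewrite /high_size mulnAC; apply: Jab; last by rewrite expn_gt0.
  exact: (ltn_trans _ (ltn_expl 12 _)).
have t'J : (J.+2 <= low_size J s)%N.
  by apply: Jab => //; exact: (ltn_trans _ (ltn_expl 10 _)).
have B0 : 0 < K ^+ 2 / 4 ^+ J by rewrite divr_gt0 ?exprn_gt0.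
have [U [mU PU HU]] := all_deviations indep law m0 n0 tau K0 bphi phiK B0 tJ t'J.
exists U; split=> // w Uw v; have {}[H1 H2 H3] := HU w Uw.
set e := fun v => emp (fun x => lincomb phi v x ^+ 2) (X^~ w).
have normalized u : \sum_k `|u k| = 1 -> \sum_k u k ^+ 2 <= 516 * e u + (16 * s%:R)^-1.
  move=> u1.
  have H3' k : emp (fun x => phi k x ^+ 2) (X^~ w) <= 3.
    apply: (le_trans (H3 k)).
    rewrite [mean _ _](_ : _ = 1); last by have := ortho k k; rewrite eqxx.
    have := column_budget n2 m0 J0 s0 K0 tau_le budget; lra.
  have J1 : 1 <= J%:R :> R by rewrite ler1n.
  have z2 : 2 <= 64 * J%:R :> R by lra.
  have TE i : (high_size J i)%:R * level K i ^+ 2 = 64 * (64 * J%:R) * K ^+ 2.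
    rewrite high_sizeE level_sqr; field.
    by rewrite expf_neq0// pnatr_eq0.
  have high0 i : (0 < high_size J i)%N by exact: leq_trans (tJ i).
  have low0 : (0 < low_size J s)%N by exact: leq_trans t'J.
  apply: le_trans (net_lower_bound (p := fun i =>
    2 * 1 * net_tau n tau (high_size J i) / m%:R)
    K0 bphi phiK ortho high0 low0 z2 TE H1 H2 H3' u1) _.
  by rewrite lerD2l; exact: (total_budget n2 m0 J0 s0 K0 sJ tau_le budget).
(* Both sides are homogeneous of degree two in [v], so [v] is scaled to l1 norm one, the zero vector
   being treated apart. *)
set c := \sum_k `|v k|.
have c_ge0 : 0 <= c by apply: sumr_ge0.
have [c0|c0] := eqVneq c 0.
  have v0 k : v k = 0.
    apply/eqP; rewrite -normr_eq0; apply/eqP.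
    by have /psumr_eq0P := c0; apply.
  rewrite big1; last by move=> k _; rewrite v0 expr0n.
  rewrite c0 expr0n mul0r addr0; apply: mulr_ge0; first exact: ler0n.
  by apply: divr_ge0 => //; apply: sumr_ge0 => j _; exact: sqr_ge0.
have c_gt0 : 0 < c by rewrite lt_neqAle eq_sym c0.
have := normalized (fun k => v k / c).
rewrite (_ : \sum_k `|v k / c| = 1); last first.
  under eq_bigr do rewrite normrM normfV (ger0_norm c_ge0).
  by rewrite -mulr_suml mulfV.
move=> /(_ erefl).
rewrite (_ : \sum_k (v k / c) ^+ 2 = (\sum_k v k ^+ 2) / c ^+ 2); last first.
  by rewrite mulr_suml; apply: eq_bigr => k _; rewrite exprMn exprVn.
rewrite (_ : e _ = e v / c ^+ 2); last first.
  rewrite /e [RHS]mulrC -empZ; congr emp; apply/funext => x.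
  rewrite -exprVn -exprMn; congr (_ ^+ 2); rewrite /lincomb mulr_sumr.
  by apply: eq_bigr => k _; rewrite mulrAC mulrC.
rewrite ler_pdivrMr ?exprn_gt0// mulrDl mulrA divfK//; last by rewrite expf_neq0.
by rewrite (mulrC _^-1).
Qed.

(** * Norms and polynomial bases *)

Section lp_norms.
Context {R : realType} (n : nat).
Implicit Types z x : 'cV[R]_n.

Lemma lpnorm1E z : lpnorm 1 z = \sum_j `|z j 0|.
Proof.
rewrite /lpnorm invr1 powRr1; last by apply: sumr_ge0 => j _; exact: powR_ge0.
by apply: eq_bigr => j _; rewrite powRr1.
Qed.

Lemma lpnorm2E z : lpnorm 2 z = Num.sqrt (\sum_j z j 0 ^+ 2).
Proof.
rewrite /lpnorm powR12_sqrt; last by apply: sumr_ge0 => j _; exact: powR_ge0.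
congr Num.sqrt; apply: eq_bigr => j _.
by rewrite powR_mulrn// real_normK ?num_real.
Qed.

(** Thresholding at [r = (S / s)^(1/q)] with [S] the sum of the [|z_j|^q]: each entry kept carries
    more than [S / s], so at most [s] are kept, and each entry dropped satisfies
    [|z_j| <= |z_j|^q r^(1-q)]. *)
Lemma stechkin (q : R) (s : nat) z : 0 < q -> q < 1 -> (0 < s)%N ->
  exists2 x, (l0norm x <= s)%N & lpnorm 1 (z - x) <= lpnorm q z * s%:R `^ (1 - q^-1).
Proof.
move=> q0 q1 s0; have sR : 0 < (s%:R : R) by rewrite ltr0n.
have qN0 : q != 0 by rewrite gt_eqF.
pose S := \sum_j `|z j 0| `^ q.
have S0 : 0 <= S by apply: sumr_ge0 => j _; exact: powR_ge0.
have [SE|SN0] := eqVneq S 0.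
  have z0 j : z j 0 = 0.
    have : `|z j 0| `^ q = 0.
      by move: SE => /psumr_eq0P; apply => // i _; exact: powR_ge0.
    by move=> /eqP; rewrite powR_eq0 normr_eq0 => /andP[/eqP].
  exists 0.
    rewrite /l0norm eq_card0// => j.
    by rewrite !inE mxE eqxx.
  rewrite lpnorm1E big1 ?mulr_ge0 ?powR_ge0// => j _.
  by rewrite !mxE z0 subr0 normr0.
have {}S0 : 0 < S by rewrite lt_neqAle eq_sym SN0.
pose r := (S / s%:R) `^ q^-1.
have r0 : 0 < r by rewrite powR_gt0// divr_gt0.
have rq : r `^ q = S / s%:R.
  by rewrite -powRrM mulVf// powRr1// divr_ge0// ltW.
exists (\col_j if r < `|z j 0| then z j 0 else 0).
  rewrite /l0norm -(ler_nat R) -(ler_pM2r (_ : 0 < S / s%:R)) ?divr_gt0//.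
  rewrite [leRHS]mulrCA mulfV ?gt_eqF// mulr1 mulr_natl -sumr_const.
  rewrite /S [leRHS](bigID (mem [set j : 'I_n | (\col_j if r < `|z j 0| then z j 0 else 0) j 0 != 0]%SET))/=.
  rewrite ler_wpDr//; first by apply: sumr_ge0 => j _; exact: powR_ge0.
  apply: ler_sum => j; rewrite inE mxE; case: ltP => [rz _|]; last by rewrite eqxx.
  rewrite -rq; apply: ge0_ler_powR; rewrite ?nnegrE ?normr_ge0 ?(ltW r0) ?(ltW q0)//; exact: ltW.
rewrite lpnorm1E.
apply: (@le_trans _ _ (\sum_j `|z j 0| `^ q * r `^ (1 - q))).
  apply: ler_sum => j _; rewrite !mxE; case: ltP => [_|zr].
    by rewrite subrr normr0 mulr_ge0// powR_ge0.
  rewrite subr0; have [->|zj] := eqVneq (z j 0) 0.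
    by rewrite normr0 mulr_ge0// powR_ge0.
  rewrite -[leLHS]powRr1// -[X in _ `^ X <= _](subrKC q 1).
  rewrite powRD; last by rewrite normr_eq0 zj implybT.
  by rewrite ler_wpM2l ?powR_ge0// ge0_ler_powR ?nnegrE//; [lra|exact: ltW].
rewrite -mulr_suml -/S powRD; last by apply/implyP => _; rewrite gt_eqF.
rewrite (powRr1 (ltW r0)) powRN rq /r powRM ?invr_ge0 ?(ltW S0) ?(ltW sR)//.
rewrite /lpnorm -/S powRD; last by apply/implyP => _; rewrite gt_eqF.
rewrite (powRr1 (ltW sR)) -(powR_inv1 (ltW sR)) -powRrM mulN1r (powR_inv1 (ltW sR)).
rewrite le_eqVlt; apply/orP; left; apply/eqP; field.
by rewrite !gt_eqF.
Qed.

End lp_norms.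

Section supnorm.
Context {R : realType} (a b : R) (ab : a < b).

Lemma supnorm_ge (g : R -> R) x : {within `[a, b], continuous g} ->
  x \in `[a, b] -> `|g x| <= supnorm a b g.
Proof.
move=> cg xab.
have cng : {within `[a, b], continuous (fun x => `|g x|)}.
  by move=> y; apply: (continuous_comp (cg y)); exact: norm_continuous.
have [c cab cmax] := EVT_max (ltW ab) cng.
apply: ub_le_sup; last by exists x.
by exists `|g c| => _ [y yab <-]; apply: cmax.
Qed.

Lemma supnorm_le (g : R -> R) M : (forall x, x \in `[a, b] -> `|g x| <= M) ->
  supnorm a b g <= M.
Proof.
move=> gM; apply: ge_sup.
  by exists `|g a|; exists a => //=; rewrite in_itv/= lexx ltW.
by move=> _ [y yab <-]; exact: gM.
Qed.

Lemma within_continuous_poly (p : {poly R}) :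
  {within `[a, b], continuous (fun x => p.[x])}.
Proof. exact/continuous_subspaceT/continuous_horner. Qed.

Lemma best_approx_pointwise (N : nat) (f : R -> R) (p : {poly R}) x :
  {within `[a, b], continuous f} -> is_best_approx a b N f p -> x \in `[a, b] ->
  `|f x - p.[x]| <= best_approx_error a b N f.
Proof.
move=> cf [_ <-] xab; apply: (@supnorm_ge (fun x => f x - p.[x])) => //.
by move=> y; apply: cvgB; [exact: cf|exact: (@within_continuous_poly p)].
Qed.

End supnorm.

Section polynomial_basis.
Context {R : realType} (N : nat) (psi : 'I_N.+1 -> {poly R}).
Context (psi_incr : strictly_increasing_degrees psi).
Context (psi_size : forall k, (size (psi k) <= N.+1)%N).
Context (psi_neq0 : forall k, psi k != 0).

(** Strictly increasing sizes between 1 and [N + 1] leave no gap: counting down from [N] gives the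
    upper bound, counting up from 0 the lower one. *)
Lemma size_basis k : size (psi k) = k.+1.
Proof.
apply/eqP; rewrite eqn_leq; apply/andP; split.
  suff H j (i : 'I_N.+1) : (i + j = N)%N -> (size (psi i) + j <= N.+1)%N.
    have := H (N - k)%N k; have := ltn_ord k; lia.
  elim: j i => [|j IH] i ij; first by rewrite addn0.
  have iN : (i.+1 < N.+1)%N by lia.
  have := IH (Ordinal iN); have := psi_incr (j := i) (k := Ordinal iN) (leqnn _).
  rewrite /=; lia.
suff H j (i : 'I_N.+1) : nat_of_ord i = j -> (j < size (psi i))%N by exact: H.
elim: j i => [|j IH] i ij; first by rewrite size_poly_gt0.
have jN : (j < N.+1)%N by have := ltn_ord i; lia.
have := IH (Ordinal jN) erefl; have := psi_incr (j := Ordinal jN) (k := i).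
rewrite /= ij; lia.
Qed.

(** Triangular elimination of the leading coefficient, possible since [psi k] has degree exactly
    [k]. *)
Lemma expansion_exists (p : {poly R}) : (size p <= N.+1)%N ->
  exists c, expansion psi c = p.
Proof.
suff H t : (t <= N.+1)%N -> forall p : {poly R}, (size p <= t)%N -> exists c, expansion psi c = p.
  exact: H.
elim: t => [_ {}p|t IH tN {}p pt].
  rewrite leqn0 size_poly_eq0 => /eqP ->; exists 0.
  by rewrite /expansion big1// => k _; rewrite mxE scale0r.
pose k := Ordinal tN.
pose a := p`_t / lead_coef (psi k).
have lc0 : lead_coef (psi k) != 0 by rewrite lead_coef_eq0.
have [|c cE] := IH (ltnW tN) (p - a *: psi k).
  apply/leq_sizeP => i ti; rewrite coefB coefZ.
  have [->|it] := eqVneq i t.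
    have -> : (psi k)`_t = lead_coef (psi k) by rewrite lead_coefE size_basis.
    by rewrite /a divfK ?subrr.
  have ti' : (t < i)%N by rewrite ltn_neqAle eq_sym it.
  rewrite !nth_default ?mulr0 ?subr0 ?size_basis//; exact: leq_trans pt ti'.
exists (c + a *: delta_mx k 0).
rewrite /expansion; under eq_bigr do rewrite !mxE scalerDl.
rewrite big_split /= -/(expansion psi c) cE (bigD1 k)//= !eqxx mulr1 big1 ?addr0 ?subrK//.
by move=> j /negbTE jk; rewrite jk mulr0 scale0r.
Qed.

Lemma coef_vectorK (p : {poly R}) : (size p <= N.+1)%N ->
  expansion psi (coef_vector psi p) = p.
Proof. by move=> /expansion_exists /(xgetPex 0). Qed.

End polynomial_basis.

(** * Recovery *)

Section density.
Context {R : realType} (a b : R) (nu : R -> R).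
Context (nu_density : is_prob_density a b nu).
Context (Q : probability R R).
Context (Qlaw : forall B : set R, measurable B ->
  (Q B = \int[lebesgue_measure]_(x in B `&` `[a, b]) (nu x)%:E)%E).

Let mu := @lebesgue_measure R.

Let density_mean_ge0 (F : R -> R) : bmeas F -> (forall x, 0 <= F x) ->
  ((mean Q F)%:E = \int[mu]_(x in `[a, b]) (F x * nu x)%:E)%E.
Proof.
move=> bF F0; have [mnu nu0 _] := nu_density.
rewrite -mean_fineK//.
have mnu' : measurable_fun setT (nu \_ `[a, b]).
  exact: (proj1 (measurable_restrictT nu (measurable_itv _)) mnu).
have nu'0 x : 0 <= (nu \_ `[a, b]) x.
  by rewrite patchE; case: ifPn => // /set_mem/nu0.
have := @ge0_integral_transfer _ _ _ _ _ _ _ Q mu id id (cst 1) (nu \_ `[a, b]) F.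
rewrite /=; under eq_integral do rewrite mul1r.
move=> ->//; last 2 first.
- by case: bF.
- move=> B mB; under eq_integral do rewrite mul1r.
  rewrite (integral_indic Q measurableT mB) setIT [LHS]Qlaw//.
  transitivity (\int[mu]_x (((fun x => (nu x)%:E) \_ (B `&` `[a, b])) x))%E.
    exact: integral_mkcond.
  apply: eq_integral => x _; rewrite !patchE indicE in_setI.
  by case: (x \in B); case: (x \in _); rewrite ?mulr1 ?mulr0 ?mul0r.
transitivity (\int[mu]_x (((fun x => (F x * nu x)%:E) \_ `[a, b]) x))%E; last first.
  exact/esym/integral_mkcond.
apply: eq_integral => x _.
by rewrite !patchE; case: ifPn => _; rewrite ?mul0r// mulrC.
Qed.

(** Adding the bound [M] makes [F] nonnegative; as [nu] has mass one, the shift adds [M] on both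
    sides. *)
Lemma density_mean (F : R -> R) : bmeas F ->
  ((mean Q F)%:E = \int[mu]_(x in `[a, b]) (F x * nu x)%:E)%E.
Proof.
move=> bF; have [mF [M FM]] := bF; have [mnu nu0 nu1] := nu_density.
have mab : measurable (`[a, b] : set (measurableTypeR R)) by exact: measurable_itv.
have inu : mu.-integrable `[a, b] (EFin \o nu).
  apply/integrableP; split; first exact/measurable_EFinP.
  rewrite [ltLHS](_ : _ = 1%E) ?ltry// -nu1.
  by apply: eq_integral => x /set_mem xab; rewrite /= ger0_norm// nu0.
have iM : mu.-integrable `[a, b] (fun x => (M * nu x)%:E).
  exact: (integrableZl mab M inu).
have iF : mu.-integrable `[a, b] (fun x => (F x * nu x)%:E).
  apply: le_integrable iM => //.
    apply/measurable_EFinP; apply: measurable_funM => //.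
    exact: measurable_funTS.
  move=> x xab; rewrite lee_fin !normrM ler_wpM2r//.
  by rewrite (le_trans (FM x))// ler_norm.
have bFM : bmeas (fun x => F x + M) by apply: bmeasD => //; exact: bmeas_cst.
have := density_mean_ge0 bFM.
rewrite meanD//; last exact: bmeas_cst.
rewrite mean_cst => H.
have {}H : ((mean Q F + M)%:E = \int[mu]_(x in `[a, b]) (F x * nu x)%:E + M%:E)%E.
  rewrite H; last by move=> x; have := FM x; rewrite ler_norml => /andP[]; lra.
  under eq_integral do rewrite mulrDl EFinD.
  rewrite integralD//; congr (_ + _)%E.
  under eq_integral do rewrite EFinM.
  by rewrite integralZl// nu1 mule1.
have fin := integrable_fin_num mab iF.
move: H; rewrite -(fineK fin) -EFinD => -[] /(congr1 (fun x => x - M)).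
by rewrite !addrK => ->.
Qed.

End density.

(** * The deterministic error bound for l1 minimization *)

Section recovery.
Context {R : realType} (N m s : nat) (a b K : R) (psi : 'I_N.+1 -> {poly R}).
Context (Theta : nat) (f : R -> R) (y : 'I_m -> R).
Context (ab : a < b) (Theta_gt0 : (0 < Theta)%N) (m0 : (0 < m)%N) (s0 : (0 < s)%N).
Context (K_ge1 : 1 <= K).
Context (psiK : forall k x, x \in `[a, b] -> `|(psi k).[x]| <= K).
Context (y_in : forall j, y j \in `[a, b]).
Context (lower : forall v : 'I_N.+1 -> R,
  \sum_k v k ^+ 2 <=
    516 * ((\sum_j (\sum_k v k * (psi k).[y j]) ^+ 2) / m%:R)
    + (\sum_k `|v k|) ^+ 2 / (16 * s%:R)).

Let A := sampling_matrix psi y.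
Let Y := sample_vector f y.

Let residual (z : 'cV[R]_N.+1) j : (A *m z - Y) j 0 = (expansion psi z).[y j] - f (y j).
Proof.
rewrite !mxE /expansion horner_sum; congr (_ - _); apply: eq_bigr => k _.
by rewrite mxE hornerZ mulrC.
Qed.

Let residual_norm (z : 'cV[R]_N.+1) : lpnorm 2 (A *m z - Y) =
  Num.sqrt (\sum_j ((expansion psi z).[y j] - f (y j)) ^+ 2).
Proof.
by rewrite lpnorm2E; congr Num.sqrt; apply: eq_bigr => j _; rewrite residual.
Qed.

Context (E : R) (c z0 : 'cV[R]_N.+1).
Context (z0E : forall x, x \in `[a, b] -> `|f x - (expansion psi z0).[x]| <= E).
Context (c_min : is_l1_minimizer A Y (Theta%:R * Num.sqrt m%:R * E) c).

Let E_ge0 : 0 <= E.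
Proof.
by apply: le_trans (z0E (x := a) _) => //; rewrite in_itv/= lexx ltW.
Qed.

Let eta := Theta%:R * Num.sqrt m%:R * E.

Let eta_ge0 : 0 <= eta.
Proof. by rewrite !mulr_ge0// sqrtr_ge0. Qed.

Let feasible_sqr (z : 'cV[R]_N.+1) : l1_feasible A Y eta z ->
  \sum_j ((expansion psi z).[y j] - f (y j)) ^+ 2 <= Theta%:R ^+ 2 * m%:R * E ^+ 2.
Proof.
rewrite /l1_feasible/= residual_norm.
set S := \sum_j _ => h.
have S0 : 0 <= S by apply: sumr_ge0 => j _; exact: sqr_ge0.
rewrite -(sqr_sqrtr S0) (_ : _ * E ^+ 2 = eta ^+ 2).
  by rewrite lerXn2r ?nnegrE ?sqrtr_ge0.
by rewrite /eta !exprMn sqr_sqrtr.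
Qed.

(** Each sample residual of [z0] is at most [E], so their l2 norm is at most [sqrt m * E], and
    [Theta >= 1]. *)
Let z0_feasible : l1_feasible A Y eta z0.
Proof.
rewrite /l1_feasible/= residual_norm.
rewrite -(ger0_norm eta_ge0) -sqrtr_sqr ler_wsqrtr//.
apply: (@le_trans _ _ (\sum_(j < m) E ^+ 2)).
  apply: ler_sum => j _; rewrite -real_normK ?num_real// distrC.
  by rewrite lerXn2r ?nnegrE ?z0E.
rewrite sumr_const card_ord -[_ *+ m]mulr_natl /eta !exprMn sqr_sqrtr//.
rewrite -mulrA ler_peMl ?mulr_ge0 ?sqr_ge0//.
by rewrite exprn_ege1// ler1n.
Qed.

Let h k := c k 0 - z0 k 0.
Let H := \sum_k `|h k|.

(** Both [c] and [z0] are feasible, so [(u - v)^2 <= 2 (u - w)^2 + 2 (v - w)^2] at each sample point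
    bounds the empirical square of the error. *)
Let h_sqr : \sum_k h k ^+ 2 <= 516 * (4 * (Theta%:R * E) ^+ 2) + H ^+ 2 / (16 * s%:R).
Proof.
apply: le_trans (lower h) _; rewrite lerD2r; apply: ler_wpM2l; first exact: ler0n.
rewrite ler_pdivrMr ?ltr0n//.
have -> : 4 * (Theta%:R * E) ^+ 2 * m%:R = 2 * (Theta%:R ^+ 2 * m%:R * E ^+ 2)
  + 2 * (Theta%:R ^+ 2 * m%:R * E ^+ 2) by ring.
have cf := feasible_sqr (proj1 c_min); have z0f := feasible_sqr z0_feasible.
apply: le_trans (lerD (ler_wpM2l _ cf) (ler_wpM2l _ z0f)) => //.
rewrite !mulr_sumr -big_split /=; apply: ler_sum => j _.
rewrite (_ : \sum_k _ = (expansion psi c).[y j] - (expansion psi z0).[y j]).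
  move: (_.[_]) (_.[_]) (f _) => u v w.
  by have := sqr_ge0 (u + v - 2 * w); nra.
rewrite /expansion !horner_sum -sumrB; apply: eq_bigr => k _.
by rewrite /h mulrBl !hornerZ.
Qed.

(** An upper bound for the square root of [s] times the right-hand side of [h_sqr]:
    [46^2 >= 4 * 516] and [(1/4)^2 = 1/16]. *)
Let err := 46 * (Num.sqrt s%:R * Theta%:R * E) + H / 4.

Let head_le (S : {set 'I_N.+1}) : (#|S| <= s)%N -> \sum_(k in S) `|h k| <= err.
Proof.
move=> Ss; have sR : 0 < (s%:R : R) by rewrite ltr0n.
have H0 : 0 <= H by apply: sumr_ge0.
have [HE|HN0] := eqVneq H 0.
  rewrite big1; first by rewrite /err HE mul0r addr0 !mulr_ge0 ?sqrtr_ge0.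
  by move=> k _; have /psumr_eq0P := HE; apply.
have {}H0 : 0 < H by rewrite lt_neqAle eq_sym HN0.
have SE : 0 <= Num.sqrt s%:R * Theta%:R * E by rewrite !mulr_ge0 ?sqrtr_ge0.
have err_gt0 : 0 < err by rewrite ltr_wpDl ?mulr_ge0// divr_gt0.
have err2 : s%:R * \sum_k h k ^+ 2 <= err ^+ 2.
  apply: le_trans (ler_wpM2l (ltW sR) h_sqr) _.
  have -> : s%:R * (516 * (4 * (Theta%:R * E) ^+ 2) + H ^+ 2 / (16 * s%:R))
    = 2064 * (Num.sqrt s%:R * Theta%:R * E) ^+ 2 + H ^+ 2 / 16.
    rewrite (_ : (_ * _ * E) ^+ 2 = Num.sqrt s%:R ^+ 2 * (Theta%:R * E) ^+ 2).
      by rewrite sqr_sqrtr ?ler0n//; field; rewrite gt_eqF.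
    by ring.
  rewrite /err; move: (_ * E) SE => u u0.
  have := mulr_ge0 u0 (ltW H0); have := sqr_ge0 u; nra.
(* Cauchy-Schwarz on [S] in the form [2 t |h| <= h^2 + t^2], with [t = err / s]. *)
have cs k : 2 * err / s%:R * `|h k| <= h k ^+ 2 + (err / s%:R) ^+ 2.
  have := sqr_ge0 (`|h k| - err / s%:R); rewrite -(real_normK (num_real (h k))).
  by nra.
have : 2 * err / s%:R * \sum_(k in S) `|h k| <= 2 * err ^+ 2 / s%:R.
  rewrite mulr_sumr; apply: le_trans (ler_sum _ (fun k _ => cs k)) _.
  rewrite big_split /= sumr_const.
  apply: (@le_trans _ _ (\sum_k h k ^+ 2 + s%:R * (err / s%:R) ^+ 2)).
    apply: lerD.
      rewrite [leRHS](bigID (mem S))/= lerDl; apply: sumr_ge0 => k _; exact: sqr_ge0.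
    by rewrite -[leLHS]mulr_natl ler_wpM2r ?sqr_ge0// ler_nat.
  rewrite ler_pdivlMr// mulrDl [X in X + _]mulrC.
  rewrite (_ : _ * (err / _) ^+ 2 * _ = err ^+ 2); last by field; rewrite gt_eqF.
  by move: err2; lra.
have s2 : 0 < 2 * err / s%:R by rewrite divr_gt0// mulr_gt0.
rewrite (_ : 2 * err ^+ 2 / s%:R = 2 * err / s%:R * err); last by ring.
by rewrite ler_pM2l.
Qed.

(** With [S] the support of [x], minimality of [||c||_1] bounds the part of [h] off [S] by its part
    on [S] plus twice the part of [z0] off [S]. Hence [H] is at most twice [err] plus twice that
    part of [z0]; the [H / 2] contained in [2 err] is absorbed, which doubles the remaining
    constants to [4] and [184 = 4 * 46]. *)
Let l1_error (x : 'cV[R]_N.+1) : (l0norm x <= s)%N ->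
  H <= 4 * lpnorm 1 (z0 - x) + 184 * (Num.sqrt s%:R * Theta%:R * E).
Proof.
move=> xs; pose S := [set j | x j 0 != 0]%SET.
have hS : \sum_(k in S) `|h k| <= err by exact: head_le.
have c_le : \sum_k `|c k 0| <= \sum_k `|z0 k 0|.
  by rewrite -!lpnorm1E; exact: (proj2 c_min).
have tail_x : \sum_(k | k \notin S) `|z0 k 0| <= lpnorm 1 (z0 - x).
  rewrite lpnorm1E [leRHS](bigID (mem S))/= ler_wpDl ?sumr_ge0//.
  apply: ler_sum => k; rewrite inE negbK => /eqP xk.
  by rewrite !mxE xk subr0.
move: c_le; rewrite (bigID (mem S)) [leRHS](bigID (mem S))/=.
have : \sum_(k in S) (`|z0 k 0| - `|h k|) <= \sum_(k in S) `|c k 0|.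
  apply: ler_sum => k _; have := ler_normB (c k 0) (h k).
  by rewrite /h opprB addrC subrK; lra.
have : \sum_(k | k \notin S) (`|h k| - `|z0 k 0|) <= \sum_(k | k \notin S) `|c k 0|.
  by apply: ler_sum => k _; have := ler_normB (c k 0) (z0 k 0); rewrite -/(h k); lra.
have HS : H = \sum_(k in S) `|h k| + \sum_(k | k \notin S) `|h k|.
  by rewrite /H (bigID (mem S)).
rewrite !sumrB; move: hS tail_x; rewrite /err HS.
lra.
Qed.

Lemma recovery (x : 'cV[R]_N.+1) : (l0norm x <= s)%N ->
  supnorm a b (fun t => f t - (expansion psi c).[t]) <=
    K * 4 * lpnorm 1 (z0 - x) + (K * 184 * Theta%:R * Num.sqrt s%:R + 1) * E.
Proof.
move=> xs; apply: supnorm_le => // t tab.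
have hK : `|(expansion psi z0).[t] - (expansion psi c).[t]| <= K * H.
  rewrite distrC /expansion !horner_sum -sumrB /H mulr_sumr.
  apply: le_trans (ler_norm_sum _ _ _) _; apply: ler_sum => k _.
  by rewrite !hornerZ -mulrBl -/(h k) normrM mulrC ler_wpM2r ?psiK.
have := ler_distD (expansion psi z0).[t] (f t) (expansion psi c).[t].
have := z0E tab.
have K0 : 0 <= K by apply: le_trans K_ge1.
have := ler_wpM2l K0 (l1_error xs).
lra.
Qed.

End recovery.

(** The comparison with an arbitrary [s]-sparse [x], outside one event that depends neither on [x]
    nor on [c]: both error bounds of the theorem are specializations. With [1 < s] the number [J] of
    levels is positive. *)
Lemma recovery_whp (R : realType) (a b : R) (nu : R -> R) (N m s Theta : nat)
    (K : R) (psi : 'I_N.+1 -> {poly R}) d (T : measurableType d)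
    (P : probability T R) (X : 'I_m -> {RV P >-> R}) (f : R -> R) (p_opt : {poly R}) :
  (0 < Theta)%N -> a < b -> is_prob_density a b nu ->
  (0 < N)%N -> (0 < m)%N -> (1 < s)%N -> 1 <= K ->
  2 ^+ 32 * K ^+ 2 * s%:R * ln s%:R ^+ 3 * ln (N.+1)%:R <= m%:R ->
  orthonormal_wrt a b nu psi -> strictly_increasing_degrees psi ->
  (forall k, (size (psi k) <= N.+1)%N) ->
  (forall k, supnorm a b (fun x => (psi k).[x]) <= K) ->
  mutually_independent X -> (forall j, has_density a b nu (X j)) ->
  {within `[a, b], continuous f} -> is_best_approx a b N f p_opt ->
  exists U, [/\ measurable U,
    (P U <= (expR (- (ln s%:R ^+ 3 * ln (N.+1)%:R)))%:E)%E &
    forall w, ~ U w -> forall c x : 'cV[R]_N.+1,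
      is_l1_minimizer (sampling_matrix psi (fun j => X j w))
        (sample_vector f (fun j => X j w))
        (Theta%:R * Num.sqrt m%:R * best_approx_error a b N f) c ->
      (l0norm x <= s)%N ->
      supnorm a b (fun t => f t - (expansion psi c).[t]) <=
        K * 4 * lpnorm 1 (coef_vector psi p_opt - x)
        + (K * 184 * Theta%:R * Num.sqrt s%:R + 1) * best_approx_error a b N f].
Proof.
move=> Theta0 ab nu_density N0 m0 s1 K1 budget ortho incr psi_size psi_le indep law fc best.
have s0 : (0 < s)%N by exact: ltnW.
have K0 : 0 < K by exact: lt_le_trans K1.
have [J0 sJ Jln lnJ] := @up_log_ln R s s1.
move: (up_log 2 s) J0 sJ Jln lnJ => J J0 sJ Jln lnJ.
have psiK k x : x \in `[a, b] -> `|(psi k).[x]| <= K.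
  move=> xab; apply: le_trans (psi_le k).
  by apply: (@supnorm_ge _ _ _ ab (fun x => (psi k).[x])) => //; exact: within_continuous_poly.
pose j0 := Ordinal m0.
pose Q : probability R R := distribution P (X j0).
have Qlaw B : measurable B ->
    (Q B = \int[lebesgue_measure]_(x in B `&` `[a, b]) (nu x)%:E)%E by exact: law.
have XQ j B : measurable B -> P (X j @^-1` B) = Q B.
  by move=> mB; rewrite Qlaw//; exact: law.
(* The law of the samples is a probability on the whole line, where a polynomial need not be
   bounded; cutting off outside [a, b] changes no integral against it. *)
pose phi k x : R := (psi k).[x] * \1_(`[a, b] : set R) x.
have phiE k x : x \in `[a, b] -> phi k x = (psi k).[x].
  by move=> xab; rewrite /phi indicE mem_set// mulr1.
have phiK k x : `|phi k x| <= K.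
  rewrite /phi indicE.
  have [/set_mem xab|_] := boolP (x \in (`[a, b] : set R)%classic).
    by rewrite mulr1 psiK.
  by rewrite mulr0 normr0 ltW.
have bphi k : bmeas (phi k).
  split; last by exists K; exact: phiK.
  apply: measurable_funM; first exact: measurable_poly.
  by apply: measurable_indic; exact: measurable_itv.
have ortho_phi j k : mean Q (fun x => phi j x * phi k x) = (j == k)%:R.
  apply: EFin_inj; rewrite (density_mean nu_density Qlaw); last exact: bmeasM.
  rewrite -ortho; apply: eq_integral => x /set_mem xab.
  by rewrite !phiE.
(* Increasing sizes alone would allow the first polynomial to vanish; orthonormality excludes it. *)
have psi_neq0 k : psi k != 0.
  apply/eqP => psi0; have := ortho_phi k k; rewrite eqxx.
  rewrite (_ : (fun x => _) = fun=> 0); last first.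
    by apply/funext => x; rewrite /phi psi0 horner0 !mul0r.
  by rewrite mean_cst => /esym/eqP; rewrite oner_eq0.
pose tau : R := ln s%:R ^+ 3 * ln (N.+1)%:R.
have lam0 : 0 <= ln (N.+1)%:R :> R by rewrite ln_ge0// ler1n.
have ln_s0 : 0 <= ln s%:R :> R by rewrite ln_ge0// ler1n.
have tau_le : tau <= J%:R ^+ 3 * ln (N.+1)%:R.
  by rewrite /tau ler_wpM2r// lerXn2r ?nnegrE.
have budget' : 2 ^+ 26 * (K ^+ 2 * s%:R * J%:R ^+ 3 * ln (N.+1)%:R) <= m%:R.
  apply: le_trans budget.
  (* The factor [64 = 2^6] from [J <= 4 ln s] turns [2^26] into [2^32]. *)
  have J3 : J%:R ^+ 3 <= 64 * ln s%:R ^+ 3 :> R.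
    have : (J%:R / 4) ^+ 3 <= ln s%:R ^+ 3 :> R.
      by rewrite lerXn2r ?nnegrE ?divr_ge0.
    rewrite exprMn; lra.
  have c0 : 0 <= 2 ^+ 26 * (K ^+ 2 * s%:R * ln (N.+1)%:R).
    apply: mulr_ge0; first exact: exprn_ge0.
    by apply: mulr_ge0 => //; apply: mulr_ge0 => //; exact: sqr_ge0.
  have := ler_wpM2l c0 J3; lra.
have [U [mU PU HU]] := restricted_lower_bound indep XQ m0 (N0 : (2 <= N.+1)%N) s0 J0 sJ
  K0 bphi phiK ortho_phi tau_le budget'.
(* The samples lie in [a, b] only almost surely; the null event where one of them does not is
   discarded as well. *)
have [||V [mV PV AV]] := union_bound (P := P)
  (A := fun j => X j @^-1` (~` `[a, b])) (c := 0).
- move=> j; rewrite -[X in measurable X]setTI.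
  by apply: measurable_funP => //; apply: measurableC; exact: measurable_itv.
- move=> j; have mab : measurable (~` `[a, b] : set R).
    by apply: measurableC; exact: measurable_itv.
  rewrite le_eqVlt; apply/orP; left; apply/eqP; apply: (etrans (law j _ mab)).
  by rewrite setICl integral_set0.
exists (U `|` V); split; first exact: measurableU.
  apply: le_trans (measureU2 P mU mV) _.
  rewrite -[leRHS]adde0; apply: leeD => //.
  by apply: le_trans PV _; rewrite mulr0.
move=> w Uw c x cmin xs.
have y_in j : X j w \in `[a, b].
  by apply/negPn/negP => /negP h; apply: Uw; right; apply: (AV j).
apply: (recovery (K := K) ab Theta0 m0 s0 K1 psiK y_in _ _ cmin xs).
- move=> v; have := HU w (fun h => Uw (or_introl h)) v.
  rewrite /emp (_ : \sum_j lincomb phi v (X j w) ^+ 2 =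
    \sum_j (\sum_k v k * (psi k).[X j w]) ^+ 2)//.
  apply: eq_bigr => j _; congr (_ ^+ 2); apply: eq_bigr => k _.
  by rewrite phiE.
- move=> t tab; rewrite (coef_vectorK incr psi_size psi_neq0) ?(proj1 best)//.
  exact: best_approx_pointwise.
Qed.

Theorem theorem3p1 (R : realType) :
  exists C D1 D2 gamma : R,
    [/\ 0 < C, 0 < D1, 0 < D2 & 0 < gamma] /\
    forall (q : R) (Theta : nat) (a b : R) (nu : R -> R)
           (N m s : nat) (K : R) (psi : 'I_N.+1 -> {poly R}),
      0 < q -> q < 1 -> (0 < Theta)%N ->
      a < b -> is_prob_density a b nu ->
      (0 < N)%N -> (0 < m)%N -> (0 < s)%N -> 1 <= K ->
      C * K ^+ 2 * s%:R * ln s%:R ^+ 3 * ln (N.+1)%:R <= m%:R ->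
      orthonormal_wrt a b nu psi ->
      strictly_increasing_degrees psi ->
      (forall k, (size (psi k) <= N.+1)%N) ->
      (forall k, supnorm a b (fun x => (psi k).[x]) <= K) ->
      forall (d : measure_display) (T : measurableType d)
             (P : probability T R) (X : 'I_m -> {RV P >-> R}),
      mutually_independent X ->
      (forall j, has_density a b nu (X j)) ->
      forall (f : R -> R) (p_opt : {poly R}),
      {within `[a, b], continuous f} ->
      is_best_approx a b N f p_opt ->
      with_prob_at_least P
        (1 - (N.+1)%:R `^ (- (gamma * ln s%:R ^+ 3)))
        [set w | forall c : 'cV[R]_N.+1,
           is_l1_minimizer
             (sampling_matrix psi (fun j => X j w))
             (sample_vector f (fun j => X j w))
             (Theta%:R * Num.sqrt m%:R * best_approx_error a b N f) c ->
           supnorm a b (fun x => f x - (expansion psi c).[x])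
             <= K * D1 * best_term_error s 1 (coef_vector psi p_opt)
                + (K * D2 * Theta%:R * Num.sqrt s%:R + 1)
                  * best_approx_error a b N f
           /\
           supnorm a b (fun x => f x - (expansion psi c).[x])
             <= K * D1 * Anorm psi q p_opt * s%:R `^ (1 - q^-1)
                + (K * D2 * Theta%:R * Num.sqrt s%:R + 1)
                  * best_approx_error a b N f].
Proof.
exists (2 ^+ 32), 4, 184, 1; split; first by split; rewrite ?exprn_gt0 ?ltr0n.
move=> q Theta a b nu N m s K psi q0 q1 Theta0 ab nu_density N0 m0 s0 K1 budget
  ortho incr psi_size psi_le d T P X indep law f p_opt fc best.
(* For [s = 1] the logarithm vanishes and the claimed probability is [1 - 1 = 0], so the empty event
   suffices. *)
rewrite mul1r; case: (ltnP 1 s) => [s1|]; last first.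
  rewrite leq_eqVlt ltnS leqn0 (gtn_eqF s0) orbF => /eqP s1; exists set0; split=> //.
  by rewrite s1 ln1 expr0n oppr0 powRr0 subrr measure0.
have [U [mU PU HU]] := recovery_whp Theta0 ab nu_density N0 m0 s1 K1 budget
  ortho incr psi_size psi_le indep law fc best.
have K4 : 0 < K * 4 by rewrite mulr_gt0// (lt_le_trans _ K1).
exists (~` U); split; first exact: measurableC.
  move=> w Uw c cmin; split.
    rewrite -lerBlDr -ler_pdivrMl//; apply: lb_le_inf.
      (* The zero vector is [s]-sparse, so the infimum is over a nonempty set and a lower bound of
         that set passes to it. *)
      exists (lpnorm 1 (coef_vector psi p_opt - 0)); exists 0 => //=.
      by rewrite /l0norm eq_card0// => j; rewrite !inE mxE eqxx.
    move=> _ [x xs <-]; rewrite ler_pdivrMl// lerBlDr.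
    exact: (HU w Uw c x cmin xs).
  have [x xs zx] := stechkin (coef_vector psi p_opt) q0 q1 s0.
  apply: le_trans (HU w Uw c x cmin xs) _; rewrite lerD2r -[leRHS]mulrA.
  exact: (ler_wpM2l (ltW K4) zx).
rewrite probability_setC// /powR gt_eqF ?ltr0n// mulNr EFinB.
exact: leeB.
Qed.
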